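(* Let $A=A(\alpha,\beta,\gamma)$ and $A'=A(\alpha',\beta',\gamma')$ be Noetherian down-up algebras over $K$ (equivalently $\beta\neq 0$ and $\beta'\neq 0$) of the same type (among the types (a), (b), (c), (d)). If both have type (d), assume also that $\mathrm{char}(K)=0$. Then $A\cong A'$ (as $K$-algebras) if and only if both of the following hold: (1) $\gamma=0$ if and only if $\gamma'=0$; and (2) either $\alpha'=\alpha$ and $\beta'=\beta$, or $\alpha'=-\alpha\beta^{-1}$ and $\beta'=\beta^{-1}$.
   Context: $K$ is an algebraically closed field. For $\alpha,\beta,\gamma\in K$, the down-up algebra $A(\alpha,\beta,\gamma)$ is the associative unital $K$-algebra with generators $d,u$ and defining relations $d^2u=\alpha\, dud+\beta\, ud^2+\gamma d$ and $du^2=\alpha\, udu+\beta\, u^2d+\gamma u$. It is known that $A(\alpha,\beta,\gamma)$ is Noetherian if and only if $\beta\neq 0$. The algebra $A(\alpha,\beta,\gamma)$ has type (a) if $\gamma=0$ and $\alpha+\beta=1$; type (b) if $\gamma=0$ and $\alpha+\beta\neq 1$; type (c) if $\gamma\neq 0$ and $\alpha+\beta\neq 1$; type (d) if $\gamma\neq 0$ and $\alpha+\beta=1$. *)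

(* Defs.v *)
From HB Require Import structures.
From mathcomp Require Import all_boot all_algebra.
From mathcomp Require Import boolp monalg.

Set Implicit Arguments.
Unset Strict Implicit.
Unset Printing Implicit Defensive.

Import GRing.Theory.

Local Open Scope ring_scope.
Local Open Scope quotient_scope.

(* An ideal is a Prop-valued predicate; the right-handed notions are the
   left-handed ones over the converse ring R^c. *)
Section Noetherian.
Variable R : nzRingType.

Definition left_ideal (I : R -> Prop) : Prop :=
  [/\ I 0, forall x y, I x -> I y -> I (x + y) & forall a x, I x -> I (a * x)].

Definition left_noetherian : Prop :=
  forall I : nat -> R -> Prop,
    (forall n, left_ideal (I n)) ->
    (forall n x, I n x -> I n.+1 x) ->
    exists N, forall n x, (N <= n)%N -> I n x -> I N x.

End Noetherian.

Definition noetherian (R : nzRingType) : Prop :=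
  left_noetherian R /\ left_noetherian R^c.

Inductive ideal_gen (R : nzRingType) (S : R -> Prop) : R -> Prop :=
| IdealGenBase x : S x -> ideal_gen S x
| IdealGen0 : ideal_gen S 0
| IdealGenD x y : ideal_gen S x -> ideal_gen S y -> ideal_gen S (x + y)
| IdealGenMl a x : ideal_gen S x -> ideal_gen S (a * x)
| IdealGenMr a x : ideal_gen S x -> ideal_gen S (x * a).

Section DownUp.
Variables (K : fieldType) (alpha beta gamma : K).

(* The free algebra on two generators, i.e. the monoid algebra over K of the
   free monoid on bool; the generator d is the letter true and u is false. *)
Definition free2 : Type := {malg K[{fmonom bool}]}.
HB.instance Definition _ := GRing.Lalgebra.on free2.

Lemma free2_scalerAr (k : K) (x y : free2) : k *: (x * y) = x * (k *: y).
Proof.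
apply/malgP => m; rewrite mcoeffZ !mcoeffMl mulr_sumr.
set E := msupp y.
have sE : finmap.fsubset (msupp (k *: y)) E by apply: msuppZ_le.
rewrite -mcoeffMl (mcoeffMlw _ (finmap.fsubset_refl _) sE).
apply: eq_bigr => i _; rewrite mulr_sumr; apply: eq_bigr => j _.
by rewrite mcoeffZ mulrnAr mulrCA.
Qed.
HB.instance Definition _ := GRing.Lalgebra_isAlgebra.Build K free2 free2_scalerAr.

Definition free_d : free2 := mkmalgU (fmu true) 1.
Definition free_u : free2 := mkmalgU (fmu false) 1.

Definition downup_rel1 : free2 :=
  free_d ^+ 2 * free_u
  - (alpha *: (free_d * free_u * free_d) + beta *: (free_u * free_d ^+ 2)
     + gamma *: free_d).

Definition downup_rel2 : free2 :=
  free_d * free_u ^+ 2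
  - (alpha *: (free_u * free_d * free_u) + beta *: (free_u ^+ 2 * free_d)
     + gamma *: free_u).

Definition downup_ideal : pred free2 :=
  fun x => `[< ideal_gen (fun r => r = downup_rel1 \/ r = downup_rel2) x >].

Lemma downup_ideal_zmod : zmod_closed downup_ideal.
Proof.
split=> [|x y /asboolP Ix /asboolP Iy]; first exact/asboolP/IdealGen0.
apply/asboolP/IdealGenD => //; rewrite -mulN1r; exact: IdealGenMl.
Qed.
HB.instance Definition _ :=
  GRing.isZmodClosed.Build free2 downup_ideal downup_ideal_zmod.

Lemma downup_idealMl a x : x \in downup_ideal -> a * x \in downup_ideal.
Proof. by move=> /asboolP Ix; apply/asboolP/IdealGenMl. Qed.

Lemma downup_idealMr a x : x \in downup_ideal -> x * a \in downup_ideal.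
Proof. by move=> /asboolP Ix; apply/asboolP/IdealGenMr. Qed.

Lemma downup_idealZ k x : x \in downup_ideal -> k *: x \in downup_ideal.
Proof. by move=> Ix; rewrite -[x]mul1r scalerAl; apply: downup_idealMl. Qed.

(* Every element of the ideal has zero constant coefficient; this makes the
   quotient nonzero, as nzRingType requires. *)
Lemma constant_term_rel (A : algType K) (ct : A -> K) (d u : A) :
  (forall a b, ct (a * b) = ct a * ct b) ->
  (forall a b, ct (a + b) = ct a + ct b) ->
  (forall a, ct (- a) = - ct a) ->
  (forall k a, ct (k *: a) = k * ct a) ->
  ct d = 0 -> ct u = 0 ->
  ct (d ^+ 2 * u - (alpha *: (d * u * d) + beta *: (u * d ^+ 2) + gamma *: d))
    = 0
  /\ ct (d * u ^+ 2 - (alpha *: (u * d * u) + beta *: (u ^+ 2 * d) + gamma *: u))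
    = 0.
Proof.
move=> ctM ctD ctN ctZ ctd ctu.
by rewrite !expr2 !(ctD, ctN, ctZ, ctM, ctd, ctu) !(mulr0, mul0r, addr0, oppr0).
Qed.

Lemma downup_ideal1 : 1 \notin downup_ideal.
Proof.
pose ct (x : free2) := mcoeff (mone : {fmonom bool}) x.
have ctM x y : ct (x * y) = ct x * ct y by exact: rmorphM.
have ctD x y : ct (x + y) = ct x + ct y by exact: mcoeffD.
have ctN x : ct (- x) = - ct x by exact: mcoeffN.
have ctZ k x : ct (k *: x) = k * ct x by exact: mcoeffZ.
have ctd : ct free_d = 0 by rewrite /ct mcoeffU fm1_eq1.
have ctu : ct free_u = 0 by rewrite /ct mcoeffU fm1_eq1.
have ct0 : ct 0 = 0 by exact: mcoeff0.
have ct1 : ct 1 = 1 by rewrite /ct mcoeff1 eqxx.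
have [ctr1 ctr2] := @constant_term_rel free2 ct free_d free_u ctM ctD ctN ctZ ctd ctu.
apply/negP => /asboolP I1; suff: ct 1 = 0 by move/eqP; rewrite ct1 oner_eq0.
elim: I1 => [x [] ->|||a x _ IH|a x _ IH].
- exact: ctr1.
- exact: ctr2.
- exact: ct0.
- by move=> x y _ IHx _ IHy; rewrite ctD IHx IHy addr0.
- by rewrite ctM IH mulr0.
- by rewrite ctM IH mul0r.
Qed.

Definition downup_zmodI : zmodClosed free2 :=
  GRing.ZmodClosed.clone free2 downup_ideal _.

Definition downup : Type := Quotient.quot downup_zmodI.
HB.instance Definition _ := GRing.Zmodule.on downup.
HB.instance Definition _ : EqQuotient free2 (Quotient.equiv downup_zmodI) downup :=
  EqQuotient.on downup.
HB.instance Definition _ := ZmodQuotient.on downup.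

Definition downup_pi (x : free2) : downup := \pi_downup x.

Lemma downup_piP x y :
  downup_pi x = downup_pi y <-> x - y \in downup_ideal.
Proof.
have -> : (x - y \in downup_ideal) = (downup_pi x == downup_pi y).
  exact: (Quotient.idealrBE downup_zmodI).
by split=> /eqP.
Qed.

Lemma downup_piK (x : downup) : downup_pi (repr x) = x.
Proof. exact: reprK. Qed.

Lemma downup_piD x y : downup_pi (x + y) = downup_pi x + downup_pi y.
Proof. by rewrite /downup_pi !piE. Qed.

Lemma downup_repr_pi x : repr (downup_pi x) - x \in downup_ideal.
Proof. by apply/downup_piP; rewrite downup_piK. Qed.

Definition downup_one : downup := downup_pi 1.
Definition downup_mul (x y : downup) : downup := downup_pi (repr x * repr y).
Definition downup_scale (k : K) (x : downup) : downup := downup_pi (k *: repr x).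

Lemma downup_piM x y :
  downup_pi (x * y) = downup_mul (downup_pi x) (downup_pi y).
Proof.
apply/esym/downup_piP; set x' := repr _; set y' := repr _.
have -> : x' * y' - x * y = (x' - x) * y' + x * (y' - y).
  by rewrite mulrBl mulrBr addrA subrK.
by apply: rpredD; [apply: downup_idealMr|apply: downup_idealMl];
  apply: downup_repr_pi.
Qed.

Lemma downup_piZ k x : downup_pi (k *: x) = downup_scale k (downup_pi x).
Proof.
apply/esym/downup_piP; rewrite -scalerBr.
exact/downup_idealZ/downup_repr_pi.
Qed.

Lemma downup_mulA : associative downup_mul.
Proof.
move=> x y z; rewrite -[x]downup_piK -[y]downup_piK -[z]downup_piK.
by rewrite -!downup_piM mulrA.
Qed.

Lemma downup_mul1 : left_id downup_one downup_mul.
Proof. by move=> x; rewrite -[x]downup_piK -!downup_piM mul1r. Qed.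

Lemma downup_mulr1 : right_id downup_one downup_mul.
Proof. by move=> x; rewrite -[x]downup_piK -!downup_piM mulr1. Qed.

Lemma downup_mulDl : left_distributive downup_mul +%R.
Proof.
move=> x y z; rewrite -[x]downup_piK -[y]downup_piK -[z]downup_piK.
by rewrite -downup_piD -!downup_piM -downup_piD mulrDl.
Qed.

Lemma downup_mulDr : right_distributive downup_mul +%R.
Proof.
move=> x y z; rewrite -[x]downup_piK -[y]downup_piK -[z]downup_piK.
by rewrite -downup_piD -!downup_piM -downup_piD mulrDr.
Qed.

Lemma downup_oner_neq0 : downup_one != 0.
Proof.
have -> : 0 = downup_pi 0 by rewrite /downup_pi !piE.
apply: contraNneq downup_ideal1 => /downup_piP.
by rewrite subr0.
Qed.

HB.instance Definition _ := GRing.Zmodule_isNzRing.Build downup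
  downup_mulA downup_mul1 downup_mulr1 downup_mulDl downup_mulDr
  downup_oner_neq0.

Lemma downup_scaleA k l x :
  downup_scale k (downup_scale l x) = downup_scale (k * l) x.
Proof. by rewrite -[x]downup_piK -!downup_piZ scalerA. Qed.

Lemma downup_scale1 : left_id 1 downup_scale.
Proof. by move=> x; rewrite -[x]downup_piK -downup_piZ scale1r. Qed.

Lemma downup_scaleDr : right_distributive downup_scale +%R.
Proof.
move=> k x y; rewrite -[x]downup_piK -[y]downup_piK.
by rewrite -downup_piD -!downup_piZ -downup_piD scalerDr.
Qed.

Lemma downup_scaleDl x : {morph downup_scale^~ x : k l / k + l}.
Proof.
by move=> k l; rewrite -[x]downup_piK -!downup_piZ -downup_piD scalerDl.
Qed.

HB.instance Definition _ := GRing.Zmodule_isLmodule.Build K downup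
  downup_scaleA downup_scale1 downup_scaleDr downup_scaleDl.

Lemma downup_scaleAl k x y :
  downup_scale k (downup_mul x y) = downup_mul (downup_scale k x) y.
Proof.
rewrite -[x]downup_piK -[y]downup_piK.
by rewrite -downup_piM -!downup_piZ -downup_piM scalerAl.
Qed.
HB.instance Definition _ := GRing.Lmodule_isLalgebra.Build K downup downup_scaleAl.

Lemma downup_scaleAr k x y :
  downup_scale k (downup_mul x y) = downup_mul x (downup_scale k y).
Proof.
rewrite -[x]downup_piK -[y]downup_piK.
by rewrite -downup_piM -!downup_piZ -downup_piM scalerAr.
Qed.
HB.instance Definition _ := GRing.Lalgebra_isAlgebra.Build K downup downup_scaleAr.

Lemma downup_pi_zmod_morphism : zmod_morphism downup_pi.
Proof. by move=> x y; rewrite /downup_pi !piE. Qed.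
HB.instance Definition _ :=
  GRing.isZmodMorphism.Build free2 downup downup_pi downup_pi_zmod_morphism.

Lemma downup_pi_monoid_morphism : monoid_morphism downup_pi.
Proof. by split=> // x y; apply: downup_piM. Qed.
HB.instance Definition _ :=
  GRing.isMonoidMorphism.Build free2 downup downup_pi downup_pi_monoid_morphism.

Lemma downup_pi_scalable : scalable downup_pi.
Proof. by move=> k x; apply: downup_piZ. Qed.
HB.instance Definition _ :=
  GRing.isScalable.Build K free2 downup *:%R downup_pi downup_pi_scalable.

Definition downup_d : downup := downup_pi free_d.
Definition downup_u : downup := downup_pi free_u.

End DownUp.

Definition alg_isomorphic (K : fieldType) (A B : algType K) : Prop :=
  exists f : {lrmorphism A -> B}, bijective f.

Variant downup_kind := TypeA | TypeB | TypeC | TypeD.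

Definition downup_type (K : fieldType) (alpha beta gamma : K) : downup_kind :=
  if gamma == 0 then (if alpha + beta == 1 then TypeA else TypeB)
  else (if alpha + beta == 1 then TypeD else TypeC).

(* Main.v *)
Require Import Defs.
From mathcomp Require Import all_boot all_algebra.
From HB Require Import structures.
From mathcomp Require Import all_order finmap.
From mathcomp Require Import boolp functions monalg zify ring.

(** Noetherianity gives beta <> 0: if beta = 0, a Verma-type module shows that the
    left ideals generated by w, wd, ..., wd^n, with w = du - alpha ud - gamma, increase
    strictly.  Scaling d and exchanging d and u give the isomorphisms.

    For the converse, let f be an isomorphism.  If gamma = gamma' = 0, f respects the
    augmentations (up to a translation when alpha = 2, beta = -1), and comparing the
    terms of degree 3 of the relations gives the parameters.  In type (c), the nontrivial
    characters form a hyperbola on which f acts by t |-> k t^(+-1), and the characters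
    with parameters t and l t, l <> 1, have a nonsplit extension exactly when
    1 - alpha l - beta l^2 = 0.

    In type (d) put q = -beta.  If q <> 1, w = du - ud - gamma/(1-q) satisfies
    dw = q wd and wu = q uw.  A faithful family of weight modules over K[y,k], graded by
    the integers, shows that the normal element f(w) of the target has degree 0, that
    q' <> 1 and that f(w) is a polynomial in w'; the same for the inverse of f makes f(w)
    a multiple of w'.  On a two-dimensional simple module the ratio of the eigenvalues of
    w is q or 1/q, hence q' is q or 1/q. *)

Set Implicit Arguments.
Unset Strict Implicit.
Unset Printing Implicit Defensive.

Import Order.TTheory GRing.Theory Num.Theory.
Local Open Scope ring_scope.

(** * The free algebra and the universal property *)

(** A presentation shows which elements vanish, but not which ones survive. Every nonvanishing
    statement therefore comes from an explicit module, and [universal_act] turns any two operators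
    satisfying the relations into an action. Type (d) is the hard case because characters say almost
    nothing there: when alpha + beta = 1 the cubic terms cancel in a commutative target, leaving
    gamma chi(d) = gamma chi(u) = 0, so only the trivial character remains. It still does one job:
    its value on w is -gamma/(1-q), which is nonzero, so f(w) has a nonzero component in degree 0,
    the starting point for showing that it has no other. Characteristic 0 keeps the weights of the
    graded module distinct, and this separates the degrees. For q = 1 there is no such w. That value
    cannot be matched with some q <> 1, because for q = 1 a normal element with nonzero component in
    degree 0 is central, while w is not. *)

Section FreeAction.
Variables (K : fieldType) (V : lmodType K) (D U : {linear V -> V}).

Definition word_act (s : seq bool) (v : V) : V :=
  foldr (fun l : bool => if l then D else U) v s.

Definition free_act (x : free2 K) (v : V) : V :=
  \sum_(m <- msupp x) mcoeff m x *: word_act m v.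

Lemma free_actEw (d : {fset {fmonom bool}}) (x : free2 K) v :
  fsubset (msupp x) d -> free_act x v = \sum_(m <- d) mcoeff m x *: word_act m v.
Proof.
move=> le; rewrite /free_act [LHS](big_fset_incl _ le) => //= m _ /mcoeff_outdom ->.
by rewrite scale0r.
Qed.

Lemma free_actU c (m : {fmonom bool}) v :
  free_act (mkmalgU m c) v = c *: word_act m v.
Proof. by rewrite (free_actEw _ msuppU_le) big_seq_fset1 mcoeffUU. Qed.

Lemma free_actD x y v : free_act (x + y) v = free_act x v + free_act y v.
Proof.
pose d := fsetU (msupp x) (msupp y).
rewrite !(@free_actEw d) ?fsubsetUl ?fsubsetUr ?msuppD_le // -big_split.
by apply: eq_bigr => m _; rewrite mcoeffD scalerDl.
Qed.

Lemma free_act0 v : free_act 0 v = 0.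
Proof. by rewrite /free_act msupp0 big_seq_fset0. Qed.

Lemma free_act_sum (I : Type) (r : seq I) (F : I -> free2 K) v :
  free_act (\sum_(i <- r) F i) v = \sum_(i <- r) free_act (F i) v.
Proof. exact: (big_morph _ (fun x y => free_actD x y v) (free_act0 v)). Qed.

Lemma free_actZ k x v : free_act (k *: x) v = k *: free_act x v.
Proof.
rewrite (@free_actEw (msupp x)) ?msuppZ_le // /free_act scaler_sumr.
by apply: eq_bigr => m _; rewrite mcoeffZ scalerA.
Qed.

Lemma word_act_linear s : linear (word_act s).
Proof. by move=> k v w; elim: s => //= -[] s ->; rewrite linearP. Qed.
HB.instance Definition _ s :=
  GRing.isLinear.Build K V V *:%R (word_act s) (word_act_linear s).

Lemma free_act_linear x : linear (free_act x).
Proof.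
move=> k v w; rewrite /free_act scaler_sumr -big_split; apply: eq_bigr => m _ /=.
by rewrite linearP scalerDr !scalerA mulrC.
Qed.
HB.instance Definition _ x :=
  GRing.isLinear.Build K V V *:%R (free_act x) (free_act_linear x).

Lemma free_actM x y v : free_act (x * y) v = free_act x (free_act y v).
Proof.
rewrite {1 2}[x]monalgE mulr_suml !free_act_sum; apply: eq_bigr => m _.
rewrite {1 2}[y]monalgE mulr_sumr !free_act_sum linear_sum; apply: eq_bigr => n _ /=.
rewrite malgM_def fgmulUU !free_actU linearZ /= scalerA.
by rewrite fmM /word_act foldr_cat.
Qed.

Lemma free_act1 v : free_act 1 v = v.
Proof. by rewrite free_actU scale1r fm1. Qed.

Lemma free_act_d v : free_act (free_d K) v = D v.
Proof. by rewrite free_actU scale1r fmU. Qed.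

Lemma free_act_u v : free_act (free_u K) v = U v.
Proof. by rewrite free_actU scale1r fmU. Qed.

End FreeAction.

Section FreeInd.
Variables (K : fieldType).

(** Words are built by prepending letters, so closure under left multiplication by the two
    generators suffices. *)
Lemma free2_ind (P : free2 K -> Prop) :
    P 1 -> (forall x y, P x -> P y -> P (x + y)) ->
    (forall k x, P x -> P (k *: x)) ->
    (forall x, P x -> P (free_d K * x)) -> (forall x, P x -> P (free_u K * x)) ->
  forall x, P x.
Proof.
move=> P1 PD PZ Pd Pu x.
have P0 : P 0 by rewrite -(scale0r 1); apply: PZ.
rewrite [x]monalgE; elim/big_ind: _ => // m _.
have -> : mkmalgU m (mcoeff m x) = mcoeff m x *: mkmalgU m 1 :> free2 K.
  by apply/malgP => k; rewrite mcoeffZ !mcoeffU mulrnAr mulr1.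
apply: PZ; case: m => s; elim: s => [|l s IHs].
  by rewrite -fmoneE.
have -> : mkmalgU (FMonom (l :: s)) 1 =
    (if l then free_d K else free_u K) * mkmalgU (FMonom s) 1.
  rewrite /free_d /free_u; have -> : FMonom (l :: s) = mmul (fmu l) (FMonom s).
    by rewrite /mmul /= fmuE fmmulE.
  by case: l; rewrite malgM_def fgmulUU mul1r.
by case: l; [apply: Pd|apply: Pu].
Qed.

End FreeInd.

Section WordCoef.
Variable K : fieldType.

Definition cw (s : seq bool) (x : free2 K) : K := mcoeff (FMonom s) x.

Lemma mcoeff_sum (x : free2 K) k :
  mcoeff k x = \sum_(m <- msupp x) mcoeff m x *+ (m == k).
Proof.
rewrite {1}[x]monalgE raddf_sum; apply: eq_bigr => m _ /=.
by rewrite mcoeffU.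
Qed.

(** In a free monoid the factorisations of s are its cuts, so the convolution defining the product
    reduces to the pairs [take i s], [drop i s]. *)
Lemma cwM s x y :
  cw s (x * y) = \sum_(i < (size s).+1) cw (take i s) x * cw (drop i s) y.
Proof.
rewrite /cw mcoeffMl.
under [RHS]eq_bigr => i _ do rewrite mcoeff_sum mulr_suml.
rewrite [RHS]exchange_big; apply: eq_bigr => k1 _ /=.
under [RHS]eq_bigr => i _ do rewrite [mcoeff (FMonom (drop i s)) y]mcoeff_sum mulr_sumr.
rewrite [RHS]exchange_big; apply: eq_bigr => k2 _ /=.
under eq_bigr => i _ do rewrite mulrnAr mulrnAl -mulrnA mulnb.
rewrite sumrMnr; congr (_ *+ _).
case: k1 k2 => [s1] [s2]; rewrite fmP fmM /=.
under eq_bigr => i _ do rewrite !fmP /= andbC.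
have [<-|ne] := eqVneq (s1 ++ s2) s; last first.
  rewrite big1 // => i _; case: eqP => //= e1; case: eqP => //= e2.
  by rewrite e1 e2 cat_take_drop eqxx in ne.
have lt_s1 : (size s1 < (size (s1 ++ s2)).+1)%N by rewrite size_cat ltnS leq_addr.
rewrite (bigD1 (Ordinal lt_s1)) //= take_size_cat // drop_size_cat // !eqxx.
rewrite big1 // => i /negP ne_i; case: eqP => //= e1; case: ne_i.
apply/eqP/val_inj => /=; move: (congr1 size e1) (ltn_ord i).
by move: (nat_of_ord i) => j; rewrite size_drop size_cat; lia.
Qed.
End WordCoef.

Definition downup_relations (K : fieldType) (alpha beta gamma : K)
    (V : lmodType K) (D U : V -> V) : Prop :=
  (forall v, D (D (U v)) =
     alpha *: D (U (D v)) + beta *: U (D (D v)) + gamma *: D v) /\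
  (forall v, D (U (U v)) =
     alpha *: U (D (U v)) + beta *: U (U (D v)) + gamma *: U v).

Lemma rmorph_rel_d (K : fieldType) (A B : algType K) (f : {lrmorphism A -> B})
    x y a b c :
  f (x ^+ 2 * y) = f (a *: (x * y * x) + b *: (y * x ^+ 2) + c *: x) ->
  f x ^+ 2 * f y = a *: (f x * f y * f x) + b *: (f y * f x ^+ 2) + c *: f x.
Proof. by rewrite !expr2 !linearD !linearZ !rmorphM. Qed.

Lemma rmorph_rel_u (K : fieldType) (A B : algType K) (f : {lrmorphism A -> B})
    x y a b c :
  f (x * y ^+ 2) = f (a *: (y * x * y) + b *: (y ^+ 2 * x) + c *: y) ->
  f x * f y ^+ 2 = a *: (f y * f x * f y) + b *: (f y ^+ 2 * f x) + c *: f y.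
Proof. by rewrite !expr2 !linearD !linearZ !rmorphM. Qed.

Lemma action_rel (K : fieldType) (A : algType K) (V : lmodType K) (act : A -> V -> V)
    (D U : V -> V) (x y : A) a b c :
    (forall s t v, act (s + t) v = act s v + act t v) ->
    (forall k s v, act (k *: s) v = k *: act s v) ->
    (forall s t v, act (s * t) v = act s (act t v)) ->
    act x =1 D -> act y =1 U -> downup_relations a b c D U ->
  forall v,
    act (x ^+ 2 * y - (a *: (x * y * x) + b *: (y * x ^+ 2) + c *: x)) v = 0 /\
    act (x * y ^+ 2 - (a *: (y * x * y) + b *: (y ^+ 2 * x) + c *: y)) v = 0.
Proof.
move=> actD actZ actM actx acty [rel_d rel_u] v; rewrite -!scaleN1r !expr2.
by rewrite !(actD, actZ, actM, actx, acty) rel_d rel_u !scaleN1r !subrr.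
Qed.

Section DownUpTheory.
Variables (K : fieldType) (alpha beta gamma : K).
Local Notation A := (downup alpha beta gamma).
Local Notation d := (downup_d alpha beta gamma).
Local Notation u := (downup_u alpha beta gamma).

Lemma downup_ind (P : A -> Prop) :
    P 1 -> (forall x y, P x -> P y -> P (x + y)) ->
    (forall k x, P x -> P (k *: x)) ->
    (forall x, P x -> P (d * x)) -> (forall x, P x -> P (u * x)) ->
  forall x, P x.
Proof.
move=> P1 PD PZ Pd Pu x; rewrite -[x]downup_piK.
elim/free2_ind: (repr x) => [|y z Py Pz|k y Py|y Py|y Py].
- by rewrite rmorph1.
- by rewrite rmorphD; apply: PD.
- by rewrite linearZ; apply: PZ.
- by rewrite rmorphM; apply: Pd.
- by rewrite rmorphM; apply: Pu.
Qed.

Lemma downup_rel_d :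
  d ^+ 2 * u = alpha *: (d * u * d) + beta *: (u * d ^+ 2) + gamma *: d.
Proof.
have : downup_pi alpha beta gamma (free_d K ^+ 2 * free_u K) =
    downup_pi alpha beta gamma (alpha *: (free_d K * free_u K * free_d K) +
      beta *: (free_u K * free_d K ^+ 2) + gamma *: free_d K).
  by apply/downup_piP/asboolP/IdealGenBase; left.
exact: (rmorph_rel_d (f := downup_pi alpha beta gamma)).
Qed.

Lemma downup_rel_u :
  d * u ^+ 2 = alpha *: (u * d * u) + beta *: (u ^+ 2 * d) + gamma *: u.
Proof.
have : downup_pi alpha beta gamma (free_d K * free_u K ^+ 2) =
    downup_pi alpha beta gamma (alpha *: (free_u K * free_d K * free_u K) +
      beta *: (free_u K ^+ 2 * free_d K) + gamma *: free_u K).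
  by apply/downup_piP/asboolP/IdealGenBase; right.
exact: (rmorph_rel_u (f := downup_pi alpha beta gamma)).
Qed.

Section Action.
Variables (V : lmodType K) (D U : {linear V -> V}).
Hypothesis rel : downup_relations alpha beta gamma D U.

(** Acts through the chosen representative; [free_act_ideal] makes the choice irrelevant. *)
Definition downup_act (x : A) (v : V) : V := free_act D U (repr x) v.
Local Notation act := downup_act.

Lemma free_act_ideal x v : x \in downup_ideal alpha beta gamma -> free_act D U x v = 0.
Proof.
move=> /asboolP Ix; elim: Ix v => [{}x [] ->||{}x y _ IHx _ IHy|a {}x _ IH|a {}x _ IH] v.
- exact: (action_rel (free_actD D U) (free_actZ D U) (free_actM D U)
    (free_act_d D U) (free_act_u D U) rel v).1.
- exact: (action_rel (free_actD D U) (free_actZ D U) (free_actM D U)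
    (free_act_d D U) (free_act_u D U) rel v).2.
- exact: free_act0.
- by rewrite free_actD IHx IHy addr0.
- by rewrite free_actM IH linear0.
- by rewrite free_actM IH.
Qed.

Lemma downup_act_pi x v : act (downup_pi alpha beta gamma x) v = free_act D U x v.
Proof.
apply/eqP; rewrite -subr_eq0 -scaleN1r -free_actZ -free_actD scaleN1r.
by rewrite free_act_ideal // downup_repr_pi.
Qed.

Lemma downup_actD x y v : act (x + y) v = act x v + act y v.
Proof. by rewrite -[x]downup_piK -[y]downup_piK -rmorphD !downup_act_pi free_actD. Qed.

Lemma downup_actZ k x v : act (k *: x) v = k *: act x v.
Proof. by rewrite -[x]downup_piK -linearZ !downup_act_pi free_actZ. Qed.

Lemma downup_actM x y v : act (x * y) v = act x (act y v).
Proof. by rewrite -[x]downup_piK -[y]downup_piK -rmorphM !downup_act_pi free_actM. Qed.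

Lemma downup_act1 v : act 1 v = v.
Proof. by rewrite -(rmorph1 (downup_pi alpha beta gamma)) downup_act_pi free_act1. Qed.

Lemma downup_act_d v : act d v = D v.
Proof. by rewrite downup_act_pi free_act_d. Qed.

Lemma downup_act_u v : act u v = U v.
Proof. by rewrite downup_act_pi free_act_u. Qed.

HB.instance Definition _ x :=
  GRing.isLinear.Build K V V *:%R (act x) (free_act_linear D U (repr x)).

End Action.

End DownUpTheory.

Record is_action (K : fieldType) (A : algType K) (V : lmodType K) (d u : A)
    (D U : V -> V) (act : A -> {linear V -> V}) : Prop := IsAction {
  actD : forall x y v, act (x + y) v = act x v + act y v;
  actZ : forall k x v, act (k *: x) v = k *: act x v;
  actM : forall x y v, act (x * y) v = act x (act y v);
  act1 : forall v, act 1 v = v;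
  act_d : forall v, act d v = D v;
  act_u : forall v, act u v = U v }.

(* The later arguments use this interface instead of [downup] itself, whose ring
   operations unification would unfold down to the free algebra. *)
Record downup_algebra (K : fieldType) (alpha beta gamma : K) (A : algType K)
    (d u : A) : Prop := DownupAlgebra {
  rel_d : d ^+ 2 * u = alpha *: (d * u * d) + beta *: (u * d ^+ 2) + gamma *: d;
  rel_u : d * u ^+ 2 = alpha *: (u * d * u) + beta *: (u ^+ 2 * d) + gamma *: u;
  gen_ind : forall P : A -> Prop,
    P 1 -> (forall x y, P x -> P y -> P (x + y)) ->
    (forall k x, P x -> P (k *: x)) ->
    (forall x, P x -> P (d * x)) -> (forall x, P x -> P (u * x)) ->
    forall x, P x;
  universal_act : forall (V : lmodType K) (D U : {linear V -> V}),
    downup_relations alpha beta gamma D U -> exists act, is_action d u D U act }.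

Lemma downup_is_downup (K : fieldType) (alpha beta gamma : K) :
  downup_algebra alpha beta gamma
    (downup_d alpha beta gamma) (downup_u alpha beta gamma).
Proof.
split; [exact: downup_rel_d|exact: downup_rel_u|exact: downup_ind|].
move=> V D U rel.
pose act x : {linear V -> V} :=
  downup_act (alpha := alpha) (beta := beta) (gamma := gamma) D U x.
exists act; split.
- exact: downup_actD.
- exact: downup_actZ.
- exact: downup_actM.
- exact: downup_act1.
- exact: downup_act_d.
- exact: downup_act_u.
Qed.

Section ActionTheory.
Variables (K : fieldType) (A : algType K) (V : lmodType K) (d u : A).
Variables (D U : V -> V) (act : A -> {linear V -> V}).
Hypothesis act_is : is_action d u D U act.

Lemma actB x y v : act (x - y) v = act x v - act y v.
Proof. by rewrite -[- y]scaleN1r (actD act_is) (actZ act_is) scaleN1r. Qed.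

Lemma act0 v : act 0 v = 0.
Proof. by rewrite -(scale0r 0) (actZ act_is) scale0r. Qed.

Lemma act_sum (I : Type) (r : seq I) (F : I -> A) v :
  act (\sum_(i <- r) F i) v = \sum_(i <- r) act (F i) v.
Proof. exact: (big_morph _ (fun x y => actD act_is x y v) (act0 v)). Qed.

End ActionTheory.

Definition lmul (K : fieldType) (B : algType K) (x y : B) : B := x * y.
Lemma lmul_linear (K : fieldType) (B : algType K) (x : B) : linear (lmul x).
Proof. by move=> k y z; rewrite /lmul mulrDr -scalerAr. Qed.
HB.instance Definition _ (K : fieldType) (B : algType K) (x : B) :=
  GRing.isLinear.Build K B B *:%R (lmul x) (lmul_linear x).

Section UniversalProperty.
Variables (K : fieldType) (alpha beta gamma : K) (A : algType K) (d u : A).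
Hypothesis dA : downup_algebra alpha beta gamma d u.
Variables (B : algType K).

(** B is a module over A through left multiplication by D and U, and the morphism sends x to its
    action on 1. By [act_F] every x acts as left multiplication by its image, which makes the map
    multiplicative. *)
Lemma universal_lift (D U : B) :
    D ^+ 2 * U = alpha *: (D * U * D) + beta *: (U * D ^+ 2) + gamma *: D ->
    D * U ^+ 2 = alpha *: (U * D * U) + beta *: (U ^+ 2 * D) + gamma *: U ->
  exists f : {lrmorphism A -> B}, f d = D /\ f u = U.
Proof.
move=> relD relU.
have rel : downup_relations alpha beta gamma (lmul D) (lmul U).
  split=> v; rewrite /lmul; [move: (congr1 (fun x => x * v) relD) |
    move: (congr1 (fun x => x * v) relU)];
    by rewrite !expr2 !mulrDl -!scalerAl !mulrA.
have [act acts] := universal_act dA rel.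
pose F x : B := act x 1.
have act_F x v : act x v = F x * v.
  rewrite /F; elim/(gen_ind dA): x v => [|x y IHx IHy|k x IHx|x IHx|x IHx] v.
  - by rewrite !(act1 acts) mul1r.
  - by rewrite !(actD acts) mulrDl IHx IHy.
  - by rewrite !(actZ acts) IHx scalerAl.
  - by rewrite !(actM acts) !(act_d acts) IHx; exact: mulrA.
  - by rewrite !(actM acts) !(act_u acts) IHx; exact: mulrA.
have FZ : zmod_morphism F by move=> x y; rewrite /F (actB acts).
have FM : monoid_morphism F.
  by split=> [|x y]; rewrite {1}/F ?(act1 acts) // (actM acts) act_F.
have FS : scalable F by move=> k x; rewrite /F (actZ acts).
pose f : {lrmorphism A -> B} := HB.pack F (GRing.isZmodMorphism.Build _ _ F FZ)
  (GRing.isMonoidMorphism.Build _ _ F FM) (GRing.isScalable.Build _ _ _ _ F FS).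
exists f; rewrite /f /= /F (act_d acts) (act_u acts).
by split; exact: mulr1.
Qed.

Lemma eq_on_gen (f g : {lrmorphism A -> B}) : f d = g d -> f u = g u -> f =1 g.
Proof.
move=> fgd fgu; elim/(gen_ind dA) => [|x y IHx IHy|k x IHx|x IHx|x IHx].
- by rewrite !rmorph1.
- by rewrite !rmorphD /= IHx IHy.
- by rewrite !linearZ /= IHx.
- by rewrite !rmorphM /= IHx fgd.
- by rewrite !rmorphM /= IHx fgu.
Qed.

Lemma comm_gen (f : {lrmorphism A -> B}) z :
  GRing.comm (f d) z -> GRing.comm (f u) z -> forall x, GRing.comm (f x) z.
Proof.
move=> cd cu; elim/(gen_ind dA) => [|x y IHx IHy|k x IHx|x IHx|x IHx].
- by rewrite rmorph1; apply/commr_sym/commr1.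
- by rewrite rmorphD /=; apply/commr_sym/commrD; apply/commr_sym.
- by rewrite linearZ /= /GRing.comm -scalerAl IHx scalerAr.
- by rewrite rmorphM /=; apply/commr_sym/commrM; apply/commr_sym.
- by rewrite rmorphM /=; apply/commr_sym/commrM; apply/commr_sym.
Qed.

Lemma comm_image (f : {lrmorphism A -> B}) :
  GRing.comm (f d) (f u) -> forall x y, GRing.comm (f x) (f y).
Proof.
move=> du x y; apply: comm_gen x; apply/commr_sym.
  by apply: comm_gen y; [exact: commr_refl | apply/commr_sym].
by apply: comm_gen y; [| exact: commr_refl].
Qed.

End UniversalProperty.

(** * Isomorphisms between down-up algebras *)

Section Isomorphisms.
Variable K : fieldType.
Implicit Types (A B C : algType K) (a b c k : K).

Definition rel_in A a b c (D U : A) : Prop :=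
  D ^+ 2 * U = a *: (D * U * D) + b *: (U * D ^+ 2) + c *: D /\
  D * U ^+ 2 = a *: (U * D * U) + b *: (U ^+ 2 * D) + c *: U.

(** In each relation the c-term has degree in D one less than the cubic terms, so scaling D by k
    only scales c. *)
Lemma rel_in_scale A a b c k (D U : A) :
  rel_in a b c D U -> rel_in a b (k * c) (k *: D) U.
Proof.
rewrite /rel_in !expr2 => -[rel_d rel_u].
rewrite !(=^~ scalerAl, =^~ scalerAr, scalerA).
split; [rewrite -[D * D * U]/((D * D) * U) rel_d | rewrite rel_u];
  rewrite !scalerDr !scalerA; congr (_ *: _ + _ *: _ + _ *: _); ring.
Qed.

(** Solved for its b-term, either relation becomes the other one with the generators exchanged. *)
Lemma rel_in_swap A a b c (D U : A) : b != 0 ->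
  rel_in a b c D U -> rel_in (- a * b^-1) b^-1 (- c * b^-1) U D.
Proof.
rewrite /rel_in !expr2 => b0 [rel_d rel_u].
have invb (x y z w : A) : x = a *: y + b *: z + c *: w ->
    z = (- a * b^-1) *: y + b^-1 *: x + (- c * b^-1) *: w.
  move=> ->; rewrite !scalerDr !scalerA mulVf // scale1r ![b^-1 * _]mulrC !mulNr.
  by rewrite !scaleNr -!addrA addKr subrr addr0.
by split; apply: invb.
Qed.

Lemma alg_isomorphic_refl A : alg_isomorphic A A.
Proof. by exists idfun; exists id. Qed.

Lemma alg_isomorphic_trans A B C :
  alg_isomorphic A B -> alg_isomorphic B C -> alg_isomorphic A C.
Proof. by move=> [f bf] [g bg]; exists (g \o f); apply: bij_comp. Qed.

Lemma alg_isomorphic_inv A B : alg_isomorphic A B ->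
  exists (f : {lrmorphism A -> B}) (g : {lrmorphism B -> A}), cancel f g /\ cancel g f.
Proof.
move=> [f [g fK gK]].
have gZ : zmod_morphism g.
  by move=> x y; apply: (can_inj fK); rewrite raddfB /= !gK.
have gM : monoid_morphism g.
  split=> [|x y]; apply: (can_inj fK); first by rewrite rmorph1 gK.
  by rewrite rmorphM /= !gK.
have gS : scalable g.
  by move=> k x; apply: (can_inj fK); rewrite linearZ /= !gK.
pose h : {lrmorphism B -> A} := HB.pack g (GRing.isZmodMorphism.Build _ _ g gZ)
  (GRing.isMonoidMorphism.Build _ _ g gM) (GRing.isScalable.Build _ _ _ _ g gS).
by exists f, h.
Qed.

Lemma downup_rel a b c : rel_in a b c (downup_d a b c) (downup_u a b c).
Proof. by split; [exact: downup_rel_d | exact: downup_rel_u]. Qed.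

Lemma cancel_gen a b c A B (d u : A) (f : {lrmorphism A -> B})
    (g : {lrmorphism B -> A}) : downup_algebra a b c d u ->
  g (f d) = d -> g (f u) = u -> cancel f g.
Proof. by move=> dA gfd gfu x; apply: (eq_on_gen dA (f := g \o f) (g := idfun)). Qed.

Lemma alg_isomorphic_gen a b c a' b' c'
    (f : {lrmorphism downup a b c -> downup a' b' c'})
    (g : {lrmorphism downup a' b' c' -> downup a b c}) :
  g (f (downup_d a b c)) = downup_d a b c ->
  g (f (downup_u a b c)) = downup_u a b c ->
  f (g (downup_d a' b' c')) = downup_d a' b' c' ->
  f (g (downup_u a' b' c')) = downup_u a' b' c' ->
  alg_isomorphic (downup a b c) (downup a' b' c').
Proof.
move=> gfd gfu fgd fgu; exists f; exists g.
  exact: cancel_gen (downup_is_downup _ _ _) gfd gfu.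
exact: cancel_gen (downup_is_downup _ _ _) fgd fgu.
Qed.

Lemma lrmorph_scale A B (f : {lrmorphism A -> B}) x y k :
  k != 0 -> f x = k^-1 *: y -> f (k *: x) = y.
Proof. by move=> k0 fx; rewrite linearZ /= fx scalerA mulfV // scale1r. Qed.

Lemma downup_scale_iso a b c k : k != 0 ->
  alg_isomorphic (downup a b (k * c)) (downup a b c).
Proof.
move=> k0; have := rel_in_scale k (downup_rel a b c) => -[rd ru].
have [f [fd fu]] := universal_lift (downup_is_downup _ _ _) rd ru.
have := rel_in_scale k^-1 (downup_rel a b (k * c)).
rewrite mulKf // => -[rd' ru'].
have [g [gd gu]] := universal_lift (downup_is_downup _ _ _) rd' ru'.
have ik0 : k^-1 != 0 by rewrite invr_eq0.
move: (fd); rewrite -[k in k *: _]invrK => fd'.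
apply: (@alg_isomorphic_gen _ _ _ _ _ _ f g).
- exact: etrans (congr1 g fd) (lrmorph_scale k0 gd).
- exact: etrans (congr1 g fu) gu.
- exact: etrans (congr1 f gd) (lrmorph_scale ik0 fd').
- exact: etrans (congr1 f gu) fu.
Qed.

Lemma downup_swap_iso a b c : b != 0 ->
  alg_isomorphic (downup a b c) (downup (- a * b^-1) b^-1 (- c * b^-1)).
Proof.
move=> b0; have ib0 : b^-1 != 0 by rewrite invr_eq0.
(* The exchange is an involution on the parameters: applied to the target it returns to (a, b,
   c). *)
have := rel_in_swap ib0 (downup_rel (- a * b^-1) b^-1 (- c * b^-1)).
rewrite invrK !mulNr !opprK !mulfVK // => -[rd ru].
have [f [fd fu]] := universal_lift (downup_is_downup _ _ _) rd ru.
have [rd' ru'] := rel_in_swap b0 (downup_rel a b c); rewrite !mulNr in rd' ru'.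
have [g [gd gu]] := universal_lift (downup_is_downup _ _ _) rd' ru'.
apply: (@alg_isomorphic_gen _ _ _ _ _ _ f g).
- exact: etrans (congr1 g fd) gu.
- exact: etrans (congr1 g fu) gd.
- exact: etrans (congr1 f gd) fu.
- exact: etrans (congr1 f gu) fd.
Qed.

Lemma downup_iso a b c a' b' c' : b != 0 -> (c = 0 <-> c' = 0) ->
  (a' = a /\ b' = b) \/ (a' = - a * b^-1 /\ b' = b^-1) ->
  alg_isomorphic (downup a b c) (downup a' b' c').
Proof.
have scale (x y z w : K) : (z = 0 <-> w = 0) ->
    alg_isomorphic (downup x y z) (downup x y w).
  move=> [z0 w0]; have [wE|wn0] := eqVneq w 0.
    by rewrite wE (w0 wE); apply: alg_isomorphic_refl.
  have zn0 : z != 0 by apply: contraNneq wn0 => /z0 ->.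
  rewrite -[z](mulfVK wn0); apply: downup_scale_iso.
  by rewrite mulf_neq0 ?invr_eq0.
move=> b0 cc' [[-> ->]|[-> ->]]; first exact: scale.
apply: alg_isomorphic_trans (downup_swap_iso a c b0) _; apply: scale.
rewrite -cc'; split=> [/eqP|->]; last by rewrite oppr0 mul0r.
by rewrite mulf_eq0 oppr_eq0 invr_eq0 (negPf b0) orbF => /eqP.
Qed.

End Isomorphisms.

(** * Noetherian down-up algebras have beta nonzero *)

Section Noetherian.
Variables (K : fieldType) (alpha gamma : K).
Local Notation V := (nat -> K^o).

(** Eigenvalues of du on sequences, with d the left shift; the recursion is the relation for beta =
    0. The starting value gamma + 1 makes w = du - alpha ud - gamma the projection to coordinate
    0. *)
Fixpoint verma_weight (n : nat) : K :=
  if n is m.+1 then alpha * verma_weight m + gamma else gamma + 1.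
Local Notation lam := verma_weight.

Definition verma_d (v : V) : V := fun j => v j.+1.
Definition verma_u (v : V) : V := fun j => if j is i.+1 then lam i * v i else 0.

Lemma verma_d_linear : linear verma_d.
Proof. by move=> k v w; apply/funext. Qed.
HB.instance Definition _ := GRing.isLinear.Build K V V *:%R verma_d verma_d_linear.

Lemma verma_u_linear : linear verma_u.
Proof.
move=> k v w; apply/funext => -[|i]; first by rewrite !fctE /= scaler0 addr0.
by rewrite !fctE /= mulrDr; congr (_ + _); rewrite /GRing.scale /= mulrCA.
Qed.
HB.instance Definition _ := GRing.isLinear.Build K V V *:%R verma_u verma_u_linear.

Lemma verma_rel : downup_relations alpha 0 gamma verma_d verma_u.
Proof.
split=> v; apply/funext => j; rewrite !fctE /verma_d /verma_u /= scale0r addr0.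
  by rewrite /GRing.scale /=; ring.
by case: j => [|i]; rewrite /GRing.scale /=; ring.
Qed.

Variables (A : algType K) (d u : A).
Hypothesis dA : downup_algebra alpha 0 gamma d u.

(** As w is the projection to coordinate 0, w d^i moves coordinate i to place 0 and kills the rest.
    On the indicator sequence of N + 1 the element w d^(N+1) is nonzero while w d^i vanishes for i
    <= N, so w d^(N+1) is not in the left ideal generated by the earlier ones. *)
Lemma downup_beta0_not_noetherian : ~ left_noetherian A.
Proof.
have [act acts] := universal_act dA verma_rel.
pose w : A := d * u - alpha *: (u * d) - gamma *: 1.
have act_dX i v j : act (d ^+ i) v j = v (i + j)%N.
  elim: i j => [|i IHi] j; first by rewrite expr0 (act1 acts).
  by rewrite exprS (actM acts) (act_d acts) /= /verma_d IHi addnS.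
have act_w v j : act w v j = if j is 0 then v 0%N else 0.
  rewrite /w !(actB acts) !(actZ acts) !(actM acts) (act1 acts) !(act_d acts).
  rewrite !(act_u acts) !fctE /= /verma_d /verma_u.
  by case: j => [|j]; rewrite /GRing.scale /=; ring.
pose I n (x : A) := exists y : nat -> A, x = \sum_(i < n.+1) y i * (w * d ^+ i).
move=> /(_ I)[n|n x [y ->]|N /(_ N.+1 (w * d ^+ N.+1))].
- split=> [|x z [y ->] [y' ->]|a x [y ->]].
  + by exists (fun=> 0); rewrite big1 // => i _; rewrite mul0r.
  + exists (fun i => y i + y' i); rewrite -big_split.
    by apply: eq_bigr => i _; exact: esym (mulrDl _ _ _).
  + by exists (fun i => a * y i); rewrite mulr_sumr; apply: eq_bigr => i _; exact: mulrA.
- exists (fun i => if (i <= n)%N then y i else 0); rewrite [RHS]big_ord_recr /=.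
  rewrite ltnn mul0r addr0; apply: eq_bigr => i _.
  by rewrite -ltnS ltn_ord.
- case=> //.
    exists (fun i => if i == N.+1 then 1 else 0); rewrite big_ord_recr /= eqxx mul1r.
    rewrite big1 ?add0r // => i _; case: eqP => [iN|]; last by rewrite mul0r.
    by move: (ltn_ord i); rewrite iN ltnn.
  move=> y /(congr1 (fun x => act x (fun i => (i == N.+1)%:R) 0%N)).
  rewrite (actM acts) act_w act_dX addn0 eqxx (act_sum acts).
  rewrite big1 => [/eqP|i _]; first by rewrite oner_eq0.
  rewrite (actM acts); set z := act (w * _) _.
  suff -> : z = 0 by rewrite linear0.
  apply/funext => j; rewrite /z (actM acts) act_w act_dX addn0.
  by case: j => //; rewrite ltn_eqF.
Qed.

End Noetherian.

Lemma noetherian_beta_neq0 (K : fieldType) (alpha beta gamma : K) :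
  noetherian (downup alpha beta gamma) -> beta != 0.
Proof.
move=> [ln _]; apply/eqP => b0; move: ln; rewrite b0.
exact: (downup_beta0_not_noetherian (downup_is_downup _ _ _)).
Qed.

(** * Types (a) and (b) *)

(** Coefficient functions of words over an abstract algebra; as with [downup_algebra], this keeps
    the free algebra folded. *)
Record word_coefs (K : fieldType) (F : algType K) (c : seq bool -> F -> K) : Prop :=
  WordCoefs {
  wcD : forall s x y, c s (x + y) = c s x + c s y;
  wcZ : forall s k x, c s (k *: x) = k * c s x;
  wc1 : forall s, c s 1 = (s == [::])%:R;
  wcM : forall s x y,
    c s (x * y) = \sum_(i < (size s).+1) c (take i s) x * c (drop i s) y }.

Lemma free2_word_coefs (K : fieldType) : word_coefs (@cw K).
Proof.
split=> [s x y|s k x|s|s x y].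
- by rewrite /cw mcoeffD.
- by rewrite /cw mcoeffZ.
- by rewrite /cw mcoeff1 fmP fm1.
- exact: cwM.
Qed.

Section Coefficients.
Variables (K : fieldType) (F : algType K) (c : seq bool -> F -> K).
Hypothesis wc : word_coefs c.

Lemma wcM0 x y : c [::] (x * y) = c [::] x * c [::] y.
Proof. by rewrite (wcM wc) big_ord1. Qed.

Lemma wcM1 l x y : c [:: l] (x * y) = c [::] x * c [:: l] y + c [:: l] x * c [::] y.
Proof. by rewrite (wcM wc) !big_ord_recl big_ord0 addr0. Qed.

Lemma wcM2 l m x y :
  c [:: l; m] (x * y) =
  c [::] x * c [:: l; m] y + c [:: l] x * c [:: m] y + c [:: l; m] x * c [::] y.
Proof. by rewrite (wcM wc) !big_ord_recl big_ord0 addr0 !addrA. Qed.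

Lemma wcM3 l m n x y :
  c [:: l; m; n] (x * y) =
  c [::] x * c [:: l; m; n] y + c [:: l] x * c [:: m; n] y +
  c [:: l; m] x * c [:: n] y + c [:: l; m; n] x * c [::] y.
Proof. by rewrite (wcM wc) !big_ord_recl big_ord0 addr0 !addrA. Qed.

Lemma wcB s x y : c s (x - y) = c s x - c s y.
Proof. by rewrite -[- y]scaleN1r (wcD wc) (wcZ wc) mulN1r. Qed.

Definition wcE := (wcB, wcD wc, wcZ wc, wcM3, wcM2, wcM1, wcM0).

Variables a b : K.
Notation d := true (only parsing).
Notation u := false (only parsing).

(** The relation ideal for gamma = 0, seen modulo words of length at least 4: nothing below degree
    3, and in degree 3 a combination of the two relations, whose coefficients are read at the words
    ddu and duu. *)
Definition rel_coefs (x : F) : Prop :=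
  [/\ forall s, (size s <= 2)%N -> c s x = 0,
      c [:: d; d; d] x = 0 /\ c [:: u; u; u] x = 0,
      c [:: d; u; d] x = - a * c [:: d; d; u] x,
      c [:: u; d; d] x = - b * c [:: d; d; u] x &
      c [:: u; d; u] x = - a * c [:: d; u; u] x /\
      c [:: u; u; d] x = - b * c [:: d; u; u] x].

Lemma rel_coefsP (x : F) : rel_coefs x -> 
  [/\ c [::] x = 0, forall l, c [:: l] x = 0 & forall l m, c [:: l; m] x = 0].
Proof. by case=> h _ _ _ _; split=> [|l|l m]; rewrite h. Qed.

Lemma rel_coefs0 : rel_coefs 0.
Proof.
have h s : c s 0 = 0 by rewrite -(scale0r 0) (wcZ wc) mul0r.
by split=> [s _||||]; rewrite ?h ?mulr0.
Qed.

Lemma rel_coefsD x y : rel_coefs x -> rel_coefs y -> rel_coefs (x + y).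
Proof.
case=> x2 [x3 x4] x5 x6 [x7 x8] [y2 [y3 y4] y5 y6 [y7 y8]].
split=> [s s2||||]; first by rewrite wcE x2 // y2 // addr0.
3: by rewrite !wcE x6 y6 mulrDr.
2: by rewrite !wcE x5 y5 mulrDr.
all: by split; rewrite !wcE ?(x3, x4, x5, x6, x7, x8, y3, y4, y5, y6, y7, y8) ?mulrDr ?addr0.
Qed.

(** With nothing below degree 3 in x, multiplication by y only scales the cubic part by [c [::]
    y]. *)
Lemma rel_coefsMl x y : rel_coefs x -> rel_coefs (y * x).
Proof.
move=> cx; case: (rel_coefsP cx) => x0 x1 x2; case: cx => _ [x3 x4] x5 x6 [x7 x8].
split=> [[|l [|m [|]]] // _||||].
all: try split; rewrite ?wcE ?(x0, x1, x2, x3, x4, x5, x6, x7, x8); by ring.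
Qed.

Lemma rel_coefsMr x y : rel_coefs x -> rel_coefs (x * y).
Proof.
move=> cx; case: (rel_coefsP cx) => x0 x1 x2; case: cx => _ [x3 x4] x5 x6 [x7 x8].
split=> [[|l [|m [|]]] // _||||].
all: try split; rewrite ?wcE ?(x0, x1, x2, x3, x4, x5, x6, x7, x8); by ring.
Qed.

Lemma rel_coefs_gen (D U : F) :
    (forall s, c s D = (s == [:: d])%:R) -> (forall s, c s U = (s == [:: u])%:R) ->
  rel_coefs (D ^+ 2 * U - (a *: (D * U * D) + b *: (U * D ^+ 2) + 0 *: D)) /\
  rel_coefs (D * U ^+ 2 - (a *: (U * D * U) + b *: (U ^+ 2 * D) + 0 *: U)).
Proof.
move=> cD cU; rewrite !scale0r !addr0 !expr2; split.
all: split=> [[|l [|m [|]]] // _||||].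
all: try split; rewrite ?wcE ?(cD, cU) /=; try case: l; try case: m; rewrite /=; by ring.
Qed.

End Coefficients.

Definition same_params (K : fieldType) (a b a' b' : K) : Prop :=
  (a' = a /\ b' = b) \/ (a' = - a * b^-1 /\ b' = b^-1).

Definition rel_expr_d (K : fieldType) (F : algType K) (a b : K) (x y : F) : F :=
  x * x * y - (a *: (x * y * x) + b *: (y * (x * x))).
Definition rel_expr_u (K : fieldType) (F : algType K) (a b : K) (x y : F) : F :=
  x * (y * y) - (a *: (y * x * y) + b *: (y * y * x)).

Section Transfer.
Variables (K : fieldType) (F : algType K) (c : seq bool -> F -> K).
Hypothesis wc : word_coefs c.
Notation d := true (only parsing).
Notation u := false (only parsing).

(** Without constant terms the cubic part depends only on the linear parts. For (a, b) = (2, -1) the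
    expression is the iterated commutator [x, [x, y]], which constants do not affect. *)
Lemma cubic_coefs a b x y l m n :
    (c [::] x = 0 /\ c [::] y = 0) \/ (a = 2%:R /\ b = -1) ->
  c [:: l; m; n] (rel_expr_d a b x y) =
    c [:: l] x * c [:: m] x * c [:: n] y - a * (c [:: l] x * c [:: m] y * c [:: n] x)
    - b * (c [:: l] y * c [:: m] x * c [:: n] x).
Proof. by rewrite /rel_expr_d !(wcE wc) => -[[-> ->]|[-> ->]]; ring. Qed.

(** If a + b = 1, the expressions are x[x,y] + b[x,y]x and [x,y]y + b y[x,y]; their coefficients at
    du are the constant terms of x and y times 1 + b times the determinant of the linear parts. If a
    + b <> 1, the linear coefficients decide. *)
Lemma rel_constants (a b a' b' : K) (x y : F) :
    c [:: d] x * c [:: u] y - c [:: u] x * c [:: d] y != 0 ->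
    rel_coefs c a' b' (rel_expr_d a b x y) -> rel_coefs c a' b' (rel_expr_u a b x y) ->
  (c [::] x = 0 /\ c [::] y = 0) \/ (a = 2%:R /\ b = -1).
Proof.
move=> Delta0 cR1 cR2.
have [R1_0 R1_1 R1_2] := rel_coefsP cR1; have [R2_0 R2_1 R2_2] := rel_coefsP cR2.
move: R1_0 (R1_1 d) (R1_1 u) (R1_2 d u) R2_0 (R2_1 d) (R2_1 u) (R2_2 d u).
rewrite /rel_expr_d /rel_expr_u !(wcE wc); move: (c [:: d; u] x) (c [:: d; u] y) => xdu ydu.
move: (c [::] x) (c [::] y) Delta0 => x0 y0.
move: (c [:: d] x) (c [:: u] x) (c [:: d] y) (c [:: u] y) => p r q s.
move=> Delta0 E10 E1d E1u E1du E20 E2d E2u E2du.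
have [ab1|ab1] := eqVneq (a + b) 1.
  have aE : a = 1 - b by rewrite -ab1 addrK.
  subst a.
  have : x0 * (1 + b) * (p * s - r * q) = 0 by rewrite -E1du; ring.
  have : y0 * (1 + b) * (p * s - r * q) = 0 by rewrite -E2du; ring.
  move=> /eqP; rewrite !mulf_eq0 (negPf Delta0) orbF => /orP[/eqP y00|b1].
    move=> /eqP; rewrite !mulf_eq0 (negPf Delta0) orbF => /orP[/eqP x00|b1]; first by left.
    by right; rewrite (_ : b = -1) ?opprK //; apply/eqP; rewrite -addr_eq0 addrC.
  by right; rewrite (_ : b = -1) ?opprK //; apply/eqP; rewrite -addr_eq0 addrC.
have ab0 : 1 - a - b != 0 by rewrite -addrA -opprD subr_eq0 eq_sym.
have sq (z : K) : z ^+ 2 = 0 -> z = 0 by move=> /eqP; rewrite sqrf_eq0 => /eqP.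
left; split; apply: sq.
  have e0 : (1 - a - b) * (x0 * x0 * y0) = 0 by rewrite -E10; ring.
  (* The linear coefficients form a system in (2 x0 y0, x0^2) with determinant ps - rq up to sign;
     eliminating 2 x0 y0 leaves x0^2 = 0 in any characteristic. *)
  have ed : (1 - a - b) * ((x0 * y0 *+ 2) * p + x0 ^+ 2 * q) = 0 by rewrite -E1d; ring.
  have eu : (1 - a - b) * ((x0 * y0 *+ 2) * r + x0 ^+ 2 * s) = 0 by rewrite -E1u; ring.
  apply/eqP; have /orP[//|] : (x0 ^+ 2 == 0) || (p * s - r * q == 0).
    rewrite -mulf_eq0; apply/eqP/(mulfI ab0); rewrite mulr0.
    transitivity ((1 - a - b) * ((x0 * y0 *+ 2) * r + x0 ^+ 2 * s) * p -
      (1 - a - b) * ((x0 * y0 *+ 2) * p + x0 ^+ 2 * q) * r); first by ring.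
    by rewrite ed eu !mul0r subr0.
  by rewrite (negPf Delta0).
have ed : (1 - a - b) * ((x0 * y0 *+ 2) * q + y0 ^+ 2 * p) = 0 by rewrite -E2d; ring.
have eu : (1 - a - b) * ((x0 * y0 *+ 2) * s + y0 ^+ 2 * r) = 0 by rewrite -E2u; ring.
apply/eqP; have /orP[//|] : (y0 ^+ 2 == 0) || (p * s - r * q == 0).
  rewrite -mulf_eq0; apply/eqP/(mulfI ab0); rewrite mulr0.
  transitivity ((1 - a - b) * ((x0 * y0 *+ 2) * q + y0 ^+ 2 * p) * s -
    (1 - a - b) * ((x0 * y0 *+ 2) * s + y0 ^+ 2 * r) * q); first by ring.
  by rewrite ed eu !mul0r subr0.
by rewrite (negPf Delta0).
Qed.

(** Let x and y have linear parts pd + ru and qd + su. If p <> 0 the parameters agree; if p = 0 they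
    are exchanged. *)
Lemma rel_coefs_params (a b a' b' : K) (x y : F) : b != 0 ->
    c [:: d] x * c [:: u] y - c [:: u] x * c [:: d] y != 0 ->
    rel_coefs c a' b' (rel_expr_d a b x y) -> rel_coefs c a' b' (rel_expr_u a b x y) ->
  same_params a b a' b'.
Proof.
move=> b0 Delta0 cR1 cR2; have x0y0 := rel_constants Delta0 cR1 cR2.
case: cR1 => _ []; rewrite !(cubic_coefs _ _ _ x0y0).
move: (c [:: d] x) (c [:: u] x) (c [:: d] y) (c [:: u] y) Delta0 => p r q s D0.
clear x0y0 => Eddd Euuu Edud Eudd [Eudu Euud].
pose t := p * s - r * q; rewrite -/t in D0.
have divb (z : K) : z * b = 1 -> z = b^-1 by move=> zb; rewrite -[b^-1]mul1r -zb mulfK.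
(* For a + b = 1 the cubic part is t((pd + ru)(du - ud) + b(du - ud)(pd + ru)), so each coefficient
   is a multiple of pt or of rt. *)
have [ab1|ab1] := eqVneq (a + b) 1.
  have aE : a = 1 - b by rewrite -ab1 addrK.
  have [p0|pn0] := eqVneq p 0; last first.
    have pt0 : p * t != 0 by rewrite mulf_neq0.
    left; split; apply: (mulIf pt0).
      suff : a * (p * t) = a' * (p * t) by [].
      apply: oppr_inj; rewrite -!mulNr.
      transitivity (p * r * q - a * (p * s * p) - b * (q * r * p)).
        by rewrite /t aE; ring.
      by rewrite [LHS]Edud /t aE; ring.
    apply: oppr_inj; rewrite -!mulNr.
    transitivity (- b' * (p * p * s - a * (p * q * r) - b * (q * p * r))).
      by rewrite /t aE; ring.
    by rewrite -Eudd /t aE; ring.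
  have rt0 : r * t != 0.
    rewrite mulf_neq0 //; apply: contraNneq D0 => r0.
    by rewrite /t p0 r0 !mul0r subrr.
  have b'E : b' = b^-1.
    apply: divb; apply: (mulIf rt0); apply: oppr_inj.
    transitivity (- b' * (p * r * s - a * (p * s * r) - b * (q * r * r))).
      by rewrite /t aE; ring.
    by rewrite -Euud /t aE; ring.
  right; split=> //; apply: (mulIf b0); rewrite mulfVK //.
  apply: (mulIf rt0); apply: oppr_inj.
  transitivity (- a' * (p * r * s - a * (p * s * r) - b * (q * r * r))).
    by rewrite /t aE; ring.
  by rewrite -Eudu /t aE; ring.
have ab0 : 1 - a - b != 0 by rewrite -addrA -opprD subr_eq0 eq_sym.
(* The coefficients at ddd and uuu force the linear part to be diagonal or antidiagonal. *)
have ppq : p * p * q = 0.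
  by apply: (mulfI ab0); rewrite mulr0 -Eddd; ring.
have rrs : r * r * s = 0.
  by apply: (mulfI ab0); rewrite mulr0 -Euuu; ring.
have [p0|pn0] := eqVneq p 0.
  have rn0 : r != 0 by apply: contraNneq D0 => r0; rewrite /t p0 r0 !mul0r subrr.
  have qn0 : q != 0 by apply: contraNneq D0 => q0; rewrite /t p0 q0 mul0r mulr0 subrr.
  have /eqP := rrs; rewrite !mulf_eq0 (negPf rn0) /= => /eqP s0.
  have qrr : q * r * r != 0 by rewrite !mulf_neq0.
  right; split.
    apply: (mulIf b0); rewrite mulfVK //; apply: (mulIf qrr).
    transitivity (- a' * (p * r * s - a * (p * s * r) - b * (q * r * r))).
      by rewrite p0 s0; ring.
    by rewrite -Eudu p0 s0; ring.
  apply: divb; apply: (mulIf qrr).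
  transitivity (- b' * (p * r * s - a * (p * s * r) - b * (q * r * r))).
    by rewrite p0 s0; ring.
  by rewrite -Euud p0 s0; ring.
have /eqP := ppq; rewrite !mulf_eq0 (negPf pn0) /= => /eqP q0.
have sn0 : s != 0 by apply: contraNneq D0 => s0; rewrite /t q0 s0 !mulr0 subrr.
have pps : p * p * s != 0 by rewrite !mulf_neq0.
left; split; apply: (mulIf pps).
  transitivity (- (- a' * (p * p * s - a * (p * q * r) - b * (q * p * r)))).
    by rewrite q0; ring.
  by rewrite -Edud q0; ring.
transitivity (- (- b' * (p * p * s - a * (p * q * r) - b * (q * p * r)))).
  by rewrite q0; ring.
by rewrite -Eudd q0; ring.
Qed.

End Transfer.

Section GradedCase.
Variables (K : fieldType) (F : algType K) (c : seq bool -> F -> K).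
Hypothesis wc : word_coefs c.
Variables (a b a' b' : K) (A B : algType K) (d u : A) (D U : F).
Variables (pi : {lrmorphism F -> B}) (rep : B -> F) (f : {lrmorphism A -> B}).
Hypotheses (dA : downup_algebra a b 0 d u) (b0 : b != 0).
Hypothesis cD : forall s, c s D = (s == [:: true])%:R.
Hypothesis cU : forall s, c s U = (s == [:: false])%:R.
Hypothesis repK : cancel rep pi.
Hypothesis pi_ker : forall x, pi x = 0 -> rel_coefs c a' b' x.
Hypothesis f_surj : forall y, exists x, f x = y.

(** The ideal starts in degree 3, so the coefficients of shorter words are well defined on B. *)
Lemma eq_coef (x y : F) s : pi x = pi y -> (size s <= 2)%N -> c s x = c s y.
Proof.
move=> xy s2; have : pi (x - y) = 0 by rewrite linearB /= xy subrr.
move=> /pi_ker [/(_ s s2) /eqP + _ _ _ _].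
by rewrite (wcB wc) subr_eq0 => /eqP.
Qed.

Let p := c [:: true] (rep (f d)).
Let r := c [:: false] (rep (f d)).
Let q := c [:: true] (rep (f u)).
Let s := c [:: false] (rep (f u)).

(* m c_d + n c_u is a derivation over the augmentation, so it vanishes on the
   image of f as soon as it vanishes at f d and f u. *)
Lemma derivation_vanishes m n : m * p + n * r = 0 -> m * q + n * s = 0 ->
  m = 0 /\ n = 0.
Proof.
move=> ed eu.
have vanish (z : F) x : pi z = f x -> m * c [:: true] z + n * c [:: false] z = 0.
  elim/(gen_ind dA): x z => [|x y IHx IHy|k x IHx|x IHx|x IHx] z zE.
  - have e1 : pi z = pi 1 by rewrite zE !rmorph1.
    by rewrite !(eq_coef e1) // !(wc1 wc) !mulr0 addr0.
  - have e1 : pi z = pi (rep (f x) + rep (f y)) by rewrite zE !raddfD /= !repK.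
    rewrite !(eq_coef e1) // !(wcD wc) !mulrDr addrACA.
    by rewrite IHx ?IHy ?repK // addr0.
  - have e1 : pi z = pi (k *: rep (f x)) by rewrite zE !linearZ /= !repK.
    rewrite !(eq_coef e1) // !(wcZ wc) !(mulrCA _ k) -mulrDr.
    by rewrite IHx ?repK // mulr0.
  - have e1 : pi z = pi (rep (f d) * rep (f x)) by rewrite zE !rmorphM /= !repK.
    rewrite !(eq_coef e1) // !(wcM1 wc) -/p -/r.
    have IH := IHx _ (repK _); move: (c [::] (rep (f x))) (c [::] _) => y0 x0.
    transitivity (x0 * (m * c [:: true] (rep (f x)) + n * c [:: false] (rep (f x)))
      + y0 * (m * p + n * r)); first by ring.
    by rewrite IH ed !mulr0 addr0.
  - have e1 : pi z = pi (rep (f u) * rep (f x)) by rewrite zE !rmorphM /= !repK.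
    rewrite !(eq_coef e1) // !(wcM1 wc) -/q -/s.
    have IH := IHx _ (repK _); move: (c [::] (rep (f x))) (c [::] _) => y0 x0.
    transitivity (x0 * (m * c [:: true] (rep (f x)) + n * c [:: false] (rep (f x)))
      + y0 * (m * q + n * s)); first by ring.
    by rewrite IH eu !mulr0 addr0.
have [x xD] := f_surj (pi D); have [y yU] := f_surj (pi U).
have := vanish _ _ (esym xD); have := vanish _ _ (esym yU).
by rewrite !cD !cU !mulr0 !mulr1 addr0 add0r.
Qed.

Lemma linear_part_invertible : p * s - r * q != 0.
Proof.
apply/eqP => D0.
(* The pairs (r, -p) and (s, -q) come from the adjugate matrix: both annihilate the linear parts
   once the determinant vanishes. Then all four entries are 0, and even (1, 0) annihilates them. *)
have [r0 p0] : r = 0 /\ - p = 0.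
  by apply: derivation_vanishes; [ring | rewrite -oppr0 -D0; ring].
have [] : s = 0 /\ - q = 0.
  apply: derivation_vanishes; last by ring.
  by move/eqP: p0; rewrite oppr_eq0 r0 => /eqP ->; ring.
move=> s0 /eqP; rewrite oppr_eq0 => /eqP q0.
have [/eqP] : (1 : K) = 0 /\ (0 : K) = 0; last by rewrite oner_eq0.
apply: derivation_vanishes; rewrite ?s0 ?q0; last by ring.
by move/eqP: p0; rewrite oppr_eq0 r0 => /eqP ->; ring.
Qed.

Lemma graded_case : same_params a b a' b'.
Proof.
apply: (rel_coefs_params wc b0 linear_part_invertible); apply: pi_ker.
  have := congr1 f (rel_d dA); rewrite scale0r addr0 !expr2.
  rewrite linearD !linearZ !rmorphM /= => E.
  rewrite /rel_expr_d linearB linearD !linearZ !rmorphM /= !repK E.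
  by apply/eqP; rewrite subr_eq0.
have := congr1 f (rel_u dA); rewrite scale0r addr0 !expr2.
rewrite linearD !linearZ !rmorphM /= => E.
rewrite /rel_expr_u linearB linearD !linearZ !rmorphM /= !repK E.
by apply/eqP; rewrite subr_eq0.
Qed.

End GradedCase.

Lemma downup_gamma0_iso (K : fieldType) (a b a' b' : K) :
    b != 0 -> alg_isomorphic (downup a b 0) (downup a' b' 0) ->
  same_params a b a' b'.
Proof.
move=> b0 [f [g fK gK]].
pose pi : {lrmorphism free2 K -> downup a' b' 0} := downup_pi a' b' 0.
have cd s : cw s (free_d K) = (s == [:: true])%:R.
  by rewrite /cw mcoeffU1 fmP fmU eq_sym.
have cu s : cw s (free_u K) = (s == [:: false])%:R.
  by rewrite /cw mcoeffU1 fmP fmU eq_sym.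
apply: (graded_case (free2_word_coefs K) (downup_is_downup a b 0) b0 cd cu
  (pi := pi) (rep := repr) (f := f)).
- exact: downup_piK.
- move=> x px; have pi0 : downup_pi a' b' 0 0 = 0 by exact: raddf0 pi.
  have [+ _] := downup_piP a' b' 0 x 0; move=> /(_ (etrans px (esym pi0))).
  rewrite subr0 => /asboolP {px}.
  have wc := free2_word_coefs K.
  have [r1 r2] := rel_coefs_gen wc a' b' cd cu.
  elim=> [{}x [] ->|||s y _ cy|s y _ cy].
  + exact: r1.
  + exact: r2.
  + exact: rel_coefs0.
  + by move=> y z _ cy _ cz; apply: rel_coefsD.
  + exact: rel_coefsMl.
  + exact: rel_coefsMr.
- by move=> y; exists (g y); exact: gK.
Qed.

(** * Type (c) *)

Section ClosedField.
Variable K : closedFieldType.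

Lemma poly_fun_eq0 (p : {poly K}) : (forall x, p.[x] = 0) -> p = 0.
Proof.
move=> p0; apply/eqP; apply: contraT => /closed_nonrootP[x].
by rewrite /root p0 eqxx.
Qed.

Lemma unit_exprz_id (n : int) : (forall s : K, s != 0 -> s ^ n = 1) -> n = 0.
Proof.
have main m : (forall s : K, s != 0 -> s ^+ m.+1 = 1) -> False.
  move=> h; have : ('X * ('X^(m.+1) - 1) : {poly K}) != 0.
    rewrite mulf_neq0 ?polyX_eq0 // -size_poly_eq0 size_XnsubC //.
  move=> /closed_nonrootP[x]; rewrite /root !hornerE => /negP[].
  have [->|x0] := eqVneq x 0; first by rewrite mul0r.
  by rewrite h // subrr mulr0.
case: n => [[|m]|m] h //; [case: (main m) | case: (main m)].
  by move=> s s0; exact: h.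
by move=> s s0; apply: invr_inj; rewrite invr1; exact: h.
Qed.

(** The units of K[X, 1/X] are monomials, phrased inside K[X]. *)
Lemma dvd_XnP (p q : {poly K}) k n : k != 0 -> p * q = k *: 'X^n ->
  exists c m, c != 0 /\ p = c *: 'X^m.
Proof.
move=> k0 pq; have : p %| ('X - 0%:P) ^+ n.
  by rewrite subr0 -(dvdpZr _ _ k0) -pq dvdp_mulr.
move=> /dvdp_exp_XsubCP[m _]; rewrite subr0 => /eqpf_eq[c c0 ->].
by exists c, m.
Qed.

End ClosedField.

(** * Characters and their pullback *)

Section CharacterTheory.
Variables (K : closedFieldType).

Lemma downup_char_at (a b c s t : K) (A : algType K) (d u : A) :
    downup_algebra a b c d u -> s * t * (1 - a - b) = c ->
  exists x : {lrmorphism A -> K^o}, x d = s /\ x u = t.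
Proof.
move=> dA cE; apply: (universal_lift dA (B := K^o)); rewrite -cE /GRing.scale /=; ring.
Qed.

Section Pullback.
Variables (a b c a' b' c' : K) (A B : algType K) (d u : A) (d' u' : B).
Hypotheses (dA : downup_algebra a b c d u) (dB : downup_algebra a' b' c' d' u').
Hypotheses (c0 : c != 0) (ab1 : a + b != 1) (c'0 : c' != 0) (ab1' : a' + b' != 1).
Let kappa := c / (1 - a - b).
Let kappa' := c' / (1 - a' - b').

Let abn0 : 1 - a - b != 0.
Proof. by rewrite -addrA -opprD subr_eq0 eq_sym. Qed.
Let abn0' : 1 - a' - b' != 0.
Proof. by rewrite -addrA -opprD subr_eq0 eq_sym. Qed.

(** Over a commutative target each relation factors, so either chi(d) chi(u) = kappa or chi vanishes
    on both generators. *)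
Lemma char_rel (chi : {lrmorphism A -> K^o}) :
  chi d * (chi d * chi u - kappa) = 0 /\ chi u * (chi d * chi u - kappa) = 0.
Proof.
split; apply: (mulfI abn0); rewrite mulr0.
  have := congr1 chi (rel_d dA); rewrite !expr2 !linearD !linearZ !rmorphM /=.
  rewrite /GRing.scale /= => E.
  transitivity (chi d * chi d * chi u - (a * (chi d * chi u * chi d)
    + b * (chi u * (chi d * chi d)) + c * chi d)); last by rewrite -E subrr.
  by rewrite -[in RHS](mulfVK abn0 c) -/kappa; ring.
have := congr1 chi (rel_u dA); rewrite !expr2 !linearD !linearZ !rmorphM /=.
rewrite /GRing.scale /= => E.
transitivity (chi d * (chi u * chi u) - (a * (chi u * chi d * chi u)
  + b * (chi u * chi u * chi d) + c * chi u)); last by rewrite -E subrr.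
by rewrite -[in RHS](mulfVK abn0 c) -/kappa; ring.
Qed.

Definition at_point (k s : K) (X : algType K) (x y : X) (chi : X -> K^o) : Prop :=
  chi x = s /\ chi y = k / s.

Lemma at_pointP s : s != 0 ->
  exists chi : {lrmorphism B -> K^o}, at_point kappa' s d' u' chi.
Proof.
by move=> s0; apply: (downup_char_at dB); rewrite mulrCA mulfV // mulr1 mulfVK.
Qed.

(** The generators take the values s and kappa' / s, so the value of a fixed element is a Laurent
    polynomial in s; s^N clears its denominator. *)
Lemma char_Laurent (x : B) : exists (P : {poly K}) N,
  forall s (chi : {lrmorphism B -> K^o}), s != 0 -> at_point kappa' s d' u' chi ->
    chi x * s ^+ N = P.[s].
Proof.
elim/(gen_ind dB): x => [|x y [P [N hP]] [Q [M hQ]]|k x [P [N hP]]|x [P [N hP]]|x [P [N hP]]].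
- by exists 1, 0%N => s chi s0 _; rewrite rmorph1 hornerC mulr1.
- exists (P * 'X^M + Q * 'X^N), (N + M)%N => s chi s0 chiP.
  rewrite rmorphD /= !hornerE -(hP s chi) // -(hQ s chi) // exprD; ring.
- exists (k *: P), N => s chi s0 chiP.
  by rewrite linearZ /= !hornerE -(hP s chi) // -mulrA.
- exists ('X * P), N => s chi s0 chiP.
  by rewrite rmorphM /= !hornerE -(hP s chi) // chiP.1 -mulrA.
- exists (kappa' *: P), N.+1 => s chi s0 chiP.
  rewrite rmorphM /= !hornerE -(hP s chi) // chiP.2 exprS.
  by rewrite -[in RHS](mulfVK s0 kappa'); ring.
Qed.

Variable f : {lrmorphism A -> B}.
Hypothesis f_surj : forall y, exists x, f x = y.

Lemma char_pullback : exists k (e : int), k != 0 /\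
  forall s (chi : {lrmorphism B -> K^o}), s != 0 -> at_point kappa' s d' u' chi ->
    at_point kappa (k * s ^ e) d u (chi \o f).
Proof.
have [P [N hP]] := char_Laurent (f d); have [Q [M hQ]] := char_Laurent (f u).
have chi_rel (chi : {lrmorphism B -> K^o}) := char_rel (chi \o f).
(* The factored relation holds at every point of the hyperbola, hence as a polynomial identity; the
   factor X absorbs s = 0, where there is no point. *)
have : 'X * (P * (P * Q - kappa *: 'X^(N + M))) = 0.
  apply: poly_fun_eq0 => s; rewrite !(hornerM, hornerX, hornerD, hornerN, hornerZ, hornerXn).
  have [->|s0] := eqVneq s 0; first by rewrite mul0r.
  have [chi chiP] := at_pointP s0; rewrite -(hP s chi) // -(hQ s chi) //.
  transitivity (s * s ^+ N * s ^+ (N + M) *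
    (chi (f d) * (chi (f d) * chi (f u) - kappa))); first by rewrite exprD; ring.
  by rewrite (chi_rel chi).1 mulr0.
move/eqP; rewrite !mulf_eq0 polyX_eq0 /= subr_eq0 => /orP[/eqP P0|/eqP PQ].
  (* If P = 0, every pullback is the trivial character; f being surjective, the characters at s and
     at 1 would then agree on d'. *)
  exfalso; have chi0 s (chi : {lrmorphism B -> K^o}) : s != 0 ->
      at_point kappa' s d' u' chi -> chi (f d) = 0 /\ chi (f u) = 0.
    move=> s0 chiP; have := hP s chi s0 chiP; rewrite P0 horner0 => /eqP.
    rewrite mulf_eq0 expf_eq0 (negPf s0) andbF orbF => /eqP fd0; split=> //.
    have /= := (chi_rel chi).2; rewrite fd0 mul0r sub0r mulrN => /eqP.
    rewrite oppr_eq0 mulf_eq0 /kappa mulf_eq0 invr_eq0 (negPf c0) (negPf abn0).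
    by rewrite !orbF => /eqP.
  have : ('X * ('X - 1) : {poly K}) != 0 by rewrite mulf_neq0 ?polyX_eq0 ?polyXsubC_eq0.
  move=> /closed_nonrootP[s]; rewrite /root !hornerE mulf_eq0 subr_eq0 => /norP[s0 s1].
  have [chi chiP] := at_pointP s0; have [chi1 chi1P] := at_pointP (oner_neq0 K).
  have chif : (chi \o f) =1 (chi1 \o f).
    apply: (eq_on_gen dA); rewrite /= ?(chi0 s chi s0 chiP).1 ?(chi0 s chi s0 chiP).2.
      by rewrite (chi0 1 chi1 (oner_neq0 K) chi1P).1.
    by rewrite (chi0 1 chi1 (oner_neq0 K) chi1P).2.
  have [x fx] := f_surj d'; have := chif x; rewrite /= fx chiP.1 chi1P.1.
  by move/eqP; rewrite (negPf s1).
have kappa0 : kappa != 0 by rewrite mulf_neq0 ?invr_eq0.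
have [k [m [k0 PE]]] := dvd_XnP kappa0 PQ.
exists k, (m%:Z - N%:Z); split=> // s chi s0 chiP.
have sX n : s ^+ n != 0 by rewrite expf_neq0.
have fd : chi (f d) = k * s ^ (m%:Z - N%:Z).
  apply: (mulIf (sX N)); rewrite (hP s chi) // PE !hornerE.
  by rewrite expfzDr // -exprnN -!exprnP mulrA mulfVK.
split=> //=; rewrite -fd; have fdn0 : chi (f d) != 0.
  by rewrite fd mulf_neq0 ?expfz_neq0.
have /= [+ _] := chi_rel chi; move/eqP; rewrite mulf_eq0 (negPf fdn0) subr_eq0 => /eqP <-.
by rewrite mulrC mulKf.
Qed.

End Pullback.
End CharacterTheory.

Lemma int_mul_eq1 (m n : int) : m * n = 1 -> (m = 1 /\ n = 1) \/ (m = -1 /\ n = -1).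
Proof.
move=> mn1; have /eqP := congr1 absz mn1; rewrite abszM muln_eq1 => /andP[/eqP m1 _].
have [mE|mE] : m = 1 \/ m = -1 by lia.
  by left; move: mn1; rewrite mE mul1r.
by right; move: mn1; rewrite mE mulN1r => <-; rewrite opprK.
Qed.

Section Matrix2.
Variable K : fieldType.
Implicit Types (M N : 'M[K]_2).

Definition mx2 (x y z t : K) : 'M[K]_2 :=
  \matrix_(i, j) if i == 0 then (if j == 0 then x else y) else (if j == 0 then z else t).

Lemma mx2E M : M = mx2 (M 0 0) (M 0 1) (M 1 0) (M 1 1).
Proof.
by apply/matrixP => i j; rewrite mxE;
  case: (unliftP 0 i) => [i'|] ->; case: (unliftP 0 j) => [j'|] -> //=;
  rewrite ?ord1; congr (M _ _); apply: val_inj.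
Qed.

Lemma mx2_inj x y z t x' y' z' t' : mx2 x y z t = mx2 x' y' z' t' ->
  [/\ x = x', y = y', z = z' & t = t'].
Proof.
by move=> /matrixP E; have := E 0 0; have := E 0 1; have := E 1 0; have := E 1 1;
  rewrite !mxE.
Qed.

Lemma mx2M x y z t x' y' z' t' :
  mx2 x y z t * mx2 x' y' z' t' =
  mx2 (x * x' + y * z') (x * y' + y * t') (z * x' + t * z') (z * y' + t * t').
Proof.
apply/matrixP => i j; rewrite -mulmxE !mxE !big_ord_recl big_ord0 addr0 !mxE /=.
by case: ifP; case: ifP.
Qed.

Lemma mx2D x y z t x' y' z' t' :
  mx2 x y z t + mx2 x' y' z' t' = mx2 (x + x') (y + y') (z + z') (t + t').
Proof. by apply/matrixP => i j; rewrite !mxE; case: ifP; case: ifP. Qed.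

Lemma mx2B x y z t x' y' z' t' :
  mx2 x y z t - mx2 x' y' z' t' = mx2 (x - x') (y - y') (z - z') (t - t').
Proof. by apply/matrixP => i j; rewrite !mxE; case: ifP; case: ifP. Qed.

Lemma mx2Z k x y z t : k *: mx2 x y z t = mx2 (k * x) (k * y) (k * z) (k * t).
Proof. by apply/matrixP => i j; rewrite !mxE; case: ifP; case: ifP. Qed.

Lemma mx2_1 : 1 = mx2 1 0 0 1.
Proof. by rewrite [LHS]mx2E !mxE. Qed.

Lemma eq_mx2 x y z t x' y' z' t' :
  x = x' -> y = y' -> z = z' -> t = t' -> mx2 x y z t = mx2 x' y' z' t'.
Proof. by move=> -> -> -> ->. Qed.

End Matrix2.

(** * Extensions of characters *)

Section Extensions.
Variable K : closedFieldType.

(** The off-diagonal entries of both relations reduce to 1 - a l - b l^2 = 0, so d may carry the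
    entry 1 that joins the characters at 1 and l. *)
Lemma triangular_rep (a b c l : K) (B : algType K) (d u : B) (k := c / (1 - a - b)) :
    downup_algebra a b c d u -> 1 - a - b != 0 -> l != 0 ->
    1 - a * l - b * l ^+ 2 = 0 ->
  exists rho : {lrmorphism B -> 'M[K]_2},
    rho d = mx2 1 1 0 l /\ rho u = mx2 k 0 0 (k / l).
Proof.
move=> dB ab0 l0 /eqP; rewrite -addrA -opprD subr_eq0 => /eqP pl.
have cE : c = k * (1 - a - b) by rewrite /k mulfVK.
apply: (universal_lift dB); rewrite !expr2 !mx2M !mx2Z !mx2D cE; apply: eq_mx2;
  clear cE; clearbody k; try (by field).
- apply: (mulIf l0); apply/eqP; rewrite -subr_eq0; apply/eqP.
  transitivity (k * (1 - (a * l + b * l ^+ 2))); first by field.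
  by rewrite -pl subrr mulr0.
- apply: (mulIf l0); apply: (mulIf l0); apply/eqP; rewrite -subr_eq0; apply/eqP.
  transitivity (k ^+ 2 * (1 - (a * l + b * l ^+ 2))); first by field.
  by rewrite -pl subrr mulr0.
Qed.

Section RootTransfer.
Variables (a b c a' b' c' : K) (A B : algType K) (d u : A) (d' u' : B).
Hypotheses (dA : downup_algebra a b c d u) (dB : downup_algebra a' b' c' d' u').
Hypotheses (c0 : c != 0) (ab1 : a + b != 1) (c'0 : c' != 0) (ab1' : a' + b' != 1).
Let kappa := c / (1 - a - b).
Let kappa' := c' / (1 - a' - b').
Variables (f : {lrmorphism A -> B}) (k : K) (e : int).
Hypothesis f_surj : forall y, exists x, f x = y.
Hypothesis k0 : k != 0.
Hypothesis f_point : forall s (chi : {lrmorphism B -> K^o}), s != 0 ->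
  at_point kappa' s d' u' chi -> at_point kappa (k * s ^ e) d u (chi \o f).

(** Pull the triangular representation back along f: its diagonal characters sit at k and k l^e. If
    l^e were not a root, the images of d and u would commute, hence by surjectivity also those of d'
    and u', which do not because l <> 1. *)
Lemma root_transfer l : 1 - a' * l - b' * l ^+ 2 = 0 ->
  1 - a * (l ^ e) - b * (l ^ e) ^+ 2 = 0.
Proof.
move=> pl.
have abn0 : 1 - a - b != 0 by rewrite -addrA -opprD subr_eq0 eq_sym.
have abn0' : 1 - a' - b' != 0 by rewrite -addrA -opprD subr_eq0 eq_sym.
have l0 : l != 0.
  by apply/eqP => l0; move/eqP: pl; rewrite l0 expr2 !mulr0 !subr0 oner_eq0.
have l1 : l != 1.
  by apply/eqP => l1; move/eqP: pl; rewrite l1 expr1n !mulr1 (negPf abn0').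
have kappa'0 : kappa' != 0 by rewrite mulf_neq0 ?invr_eq0.
have kappa0 : kappa != 0 by rewrite mulf_neq0 ?invr_eq0.
have [rho []] := triangular_rep dB abn0' l0 pl; rewrite -/kappa' => rd ru.
have [chi1 chi1P] := at_pointP dB ab1' (oner_neq0 K).
have [chil chilP] := at_pointP dB ab1' l0.
have tri x : exists y, rho x = mx2 (chi1 x) y 0 (chil x).
  elim/(gen_ind dB): x => [|x y [v vE] [w wE]|m x [v vE]|x [v vE]|x [v vE]].
  - by exists 0; rewrite !rmorph1 [LHS]mx2_1.
  - by exists (v + w); rewrite !rmorphD /= vE wE mx2D addr0.
  - by exists (m * v); rewrite !linearZ /= vE mx2Z mulr0.
  - exists (v + chil x); rewrite !rmorphM /= vE rd mx2M chi1P.1 chilP.1.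
    by rewrite !mul0r !mulr0 !mul1r !addr0 add0r.
  - exists (kappa' * v); rewrite !rmorphM /= vE ru mx2M chi1P.2 chilP.2.
    by rewrite !mul0r !mulr0 !addr0 add0r divr1.
have [x xE] := tri (f d); have [y yE] := tri (f u).
have [/= f1d f1u] := f_point (oner_neq0 K) chi1P.
have [/= fld flu] := f_point l0 chilP.
move: xE yE; rewrite f1d f1u fld flu exp1rz mulr1.
have m0 : l ^ e != 0 by rewrite expfz_neq0.
move: (l ^ e) m0 {fld flu f1d f1u} => m m0 xE yE.
apply/eqP; apply: contraT => pm; exfalso.
(* Up to a unit, the off-diagonal entry of the d-relation is (1 - a m - b m^2)(k^2 y m + kappa
   x). *)
have xyE : k ^+ 2 * y * m = - (kappa * x).
  have := congr1 (rho \o f) (rel_d dA); rewrite /= !expr2 !linearD !linearZ !rmorphM /=.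
  rewrite xE yE !mx2M !mx2Z !mx2D => /mx2_inj[_ E _ _].
  apply/eqP; rewrite -addr_eq0; apply/eqP; apply: (mulfI pm); rewrite mulr0.
  have cE : c = kappa * (1 - a - b) by rewrite mulfVK.
  rewrite cE in E; move: kappa E kappa0 => z E z0.
  move/eqP: E; rewrite -subr_eq0 => /eqP E.
  apply: (mulIf (invr_neq0 m0)); rewrite mul0r -E; field.
  by rewrite m0 k0.
have comm_du : GRing.comm ((rho \o f) d) ((rho \o f) u).
  rewrite /GRing.comm /= xE yE !mx2M; apply: eq_mx2; try by ring.
  apply/eqP; rewrite -subr_eq0; apply/eqP.
  transitivity ((k ^+ 2 * y * m - - (kappa * x)) * (1 - m) / (k * m)).
    by field; rewrite m0 k0.
  by rewrite xyE subrr !mul0r.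
have [z zE] := f_surj d'; have [t tE] := f_surj u'.
have := comm_image dA comm_du z t; rewrite /GRing.comm /= zE tE rd ru !mx2M.
move=> /mx2_inj[_ + _ _]; rewrite !mulr0 !mul0r !mulr1 add0r mul1r addr0 => /eqP.
rewrite -subr_eq0 -[X in _ - X]mulr1 -mulrBr mulf_eq0 (negPf kappa'0) subr_eq0.
by rewrite invr_eq1 (negPf l1).
Qed.

End RootTransfer.

Lemma quadratic_roots (a b : K) : b != 0 -> exists r1 r2,
  [/\ r1 + r2 = - a / b, r1 * r2 = - b^-1 &
      forall l, 1 - a * l - b * l ^+ 2 = 0 <-> l = r1 \/ l = r2].
Proof.
move=> b0.
have [r rE] := solve_monicpoly (fun i => if i == 0%N then b^-1 else - a / b) (n := 2) isT.
rewrite !big_ord_recl big_ord0 /= expr0 expr1 mulr1 addr0 in rE.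
exists r, (- a / b - r); have prodE : r * (- a / b - r) = - b^-1.
  by rewrite mulrBr -expr2 rE mulrC opprD addrCA subrr addr0.
split=> //; first by rewrite addrC subrK.
move=> l; have -> : 1 - a * l - b * l ^+ 2 = - b * ((l - r) * (l - (- a / b - r))).
  transitivity (- b * (l ^+ 2 + a / b * l + r * (- a / b - r))); last by ring.
  by rewrite prodE; field.
split=> [/eqP|[->|->]]; last 2 first.
- by rewrite subrr mul0r mulr0.
- by rewrite subrr !mulr0.
by rewrite !mulf_eq0 oppr_eq0 (negPf b0) /= !subr_eq0 => /orP[/eqP->|/eqP->]; [left|right].
Qed.

(** Two pairs listing the same set also agree in multiplicities, which covers the case of a double
    root. *)
Lemma same_pair (r1 r2 s1 s2 : K) :
    r1 = s1 \/ r1 = s2 -> r2 = s1 \/ r2 = s2 ->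
    s1 = r1 \/ s1 = r2 -> s2 = r1 \/ s2 = r2 ->
  s1 + s2 = r1 + r2 /\ s1 * s2 = r1 * r2.
Proof.
move=> [->|->] [->|->] // h1 h2.
- by have -> : s2 = s1 by case: h2.
- by rewrite addrC mulrC.
- by have -> : s1 = s2 by case: h1.
Qed.

Lemma typeC_iso (a b c a' b' c' : K) (A B : algType K) (d u : A) (d' u' : B)
    (f : {lrmorphism A -> B}) (g : {lrmorphism B -> A}) :
    downup_algebra a b c d u -> downup_algebra a' b' c' d' u' ->
    cancel f g -> cancel g f -> b != 0 -> b' != 0 ->
    c != 0 -> c' != 0 -> a + b != 1 -> a' + b' != 1 ->
  same_params a b a' b'.
Proof.
move=> dA dB fK gK b0 b'0 c0 c'0 ab1 ab1'.
have f_surj y : exists x, f x = y by exists (g y).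
have g_surj y : exists x, g x = y by exists (f y).
have [k [e [k0 fP]]] := char_pullback dA dB c0 ab1 ab1' f_surj.
have [k' [e' [k'0 gP]]] := char_pullback dB dA c'0 ab1' ab1 g_surj.
have sE s : s != 0 -> s = k' * (k * s ^ e) ^ e'.
  move=> s0; have [chi chiP] := at_pointP dB ab1' s0.
  have t0 : k * s ^ e != 0 by rewrite mulf_neq0 ?expfz_neq0.
  have [/= + _] := gP _ (chi \o f) t0 (fP _ _ s0 chiP).
  by rewrite gK chiP.1.
(* The value s = 1 isolates the constant; what remains is s^(e e' - 1) = 1 for all nonzero s, so e
   e' = 1. *)
have k1 : k' * k ^ e' = 1 by rewrite [RHS](sE 1) ?oner_neq0 // exp1rz mulr1.
have : e * e' - 1 = 0.
  apply: (@unit_exprz_id K) => s s0; rewrite expfzDr // exprN1 -exprz_exp.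
  by rewrite -[(s ^ e) ^ e']mul1r -k1 -mulrA -expfzMl -sE // mulfV.
move=> /eqP; rewrite subr_eq0 => /eqP ee'.
have ff := root_transfer dA dB c0 ab1 c'0 ab1' f_surj k0 fP.
have gg := root_transfer dB dA c'0 ab1' c0 ab1 g_surj k'0 gP.
have [r1 [r2 [rS rP rE]]] := quadratic_roots a b0.
have [s1 [s2 [sS sP sE']]] := quadratic_roots a' b'0.
have bE : b' = - (s1 * s2)^-1 by rewrite sP invrN invrK opprK.
have aE : a' = - b' * (s1 + s2) by rewrite sS; field.
have bE0 : b = - (r1 * r2)^-1 by rewrite rP invrN invrK opprK.
have [r10 r20] : r1 != 0 /\ r2 != 0.
  apply/andP; rewrite -negb_or -mulf_eq0 rP oppr_eq0 invr_eq0 //.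
have ff' l : l = s1 \/ l = s2 -> l ^ e = r1 \/ l ^ e = r2 by move=> /sE' /ff /rE.
have gg' l : l = r1 \/ l = r2 -> l ^ e' = s1 \/ l ^ e' = s2 by move=> /rE /gg /sE'.
have [fs1 fs2] := (ff' s1 (or_introl erefl), ff' s2 (or_intror erefl)).
have [gr1 gr2] := (gg' r1 (or_introl erefl), gg' r2 (or_intror erefl)).
(* For e = 1 the two quadratics have the same roots, for e = -1 inverse roots; Vieta's formulas turn
   this into the two alternatives. *)
have [[eE e'E]|[eE e'E]] : (e = 1 /\ e' = 1) \/ (e = -1 /\ e' = -1)
    by exact: int_mul_eq1.
  rewrite eE !expr1z in fs1 fs2; rewrite e'E !expr1z in gr1 gr2.
  have [SE PE] := same_pair gr1 gr2 fs1 fs2.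
  have bb : b' = b by rewrite bE bE0 PE.
  by left; split=> //; rewrite aE SE rS bb; field.
have inv_swap (x y z : K) : x ^-1 = y \/ x^-1 = z -> x = y^-1 \/ x = z^-1.
  by case=> <-; rewrite invrK; [left|right].
rewrite eE !exprN1 in fs1 fs2; rewrite e'E !exprN1 in gr1 gr2.
have [SE PE] := same_pair gr1 gr2 (inv_swap _ _ _ fs1) (inv_swap _ _ _ fs2).
have bb : b' = b^-1 by rewrite bE PE -invfM invrK rP opprK.
right; split=> //; rewrite aE SE bb -[- a](mulfVK b0) -rS.
have -> : b = - (r1 * r2)^-1 by [].
by field; rewrite r10 r20 oppr_eq0 oner_eq0. 
Qed.

End Extensions.

(** * Type (d) *)

Lemma poly2_morph_ext (R : comNzRingType) (S : nzRingType)
    (F G : {rmorphism {poly {poly R}} -> S}) :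
    (forall k, F k%:P%:P = G k%:P%:P) -> F 'X%:P = G 'X%:P -> F 'X = G 'X ->
  F =1 G.
Proof.
move=> FGC FGy FGX; elim/poly_ind => [|P k IHP]; first by rewrite !rmorph0.
rewrite !rmorphD !rmorphM /= IHP FGX; congr (_ + _).
elim/poly_ind: k => [|k x IHk]; first by rewrite polyC0 !rmorph0.
by rewrite !rmorphD !rmorphM /= IHk FGC FGy.
Qed.

(** * The shift automorphism of K[y,k] *)

Section Shift.
Variables (K : fieldType) (q c e : K).
Hypothesis q0 : q != 0.
Let g := c - (1 - q) * e.
Local Notation D := {poly {poly K}}.

(* In K[y][k], 'X%:P is y = du - ud - e and 'X is k = du; [shift] is the automorphism
   with P u = u (shift P), see [ev_u].  The parameter e is free: for q <> 1 the value
   e = c / (1 - q) gives g = 0, so that [shift] scales y by q. *)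
Definition shift (P : D) : D :=
  map_poly (comp_poly (q *: 'X + g%:P)) P \Po ('X + (q *: 'X + (q * e + c)%:P)%:P).
(** The image k - (y + e) of k stands for ud, as [ev_unshiftX] confirms. *)
Definition unshift (P : D) : D :=
  map_poly (comp_poly (q^-1 *: ('X - g%:P))) P \Po ('X - ('X + e%:P)%:P).

HB.instance Definition _ := GRing.RMorphism.copy shift
  (comp_poly ('X + (q *: 'X + (q * e + c)%:P)%:P) \o map_poly (comp_poly (q *: 'X + g%:P))).
HB.instance Definition _ := GRing.RMorphism.copy unshift
  (comp_poly ('X - ('X + e%:P)%:P) \o map_poly (comp_poly (q^-1 *: ('X - g%:P)))).

Lemma shiftC k : shift k%:P%:P = k%:P%:P.
Proof. by rewrite /shift map_polyC /= !comp_polyC. Qed.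
Lemma unshiftC k : unshift k%:P%:P = k%:P%:P.
Proof. by rewrite /unshift map_polyC /= !comp_polyC. Qed.
Lemma shiftP (p : {poly K}) : shift p%:P = (p \Po (q *: 'X + g%:P))%:P.
Proof. by rewrite /shift map_polyC comp_polyC. Qed.
Lemma unshiftP (p : {poly K}) : unshift p%:P = (p \Po (q^-1 *: ('X - g%:P)))%:P.
Proof. by rewrite /unshift map_polyC comp_polyC. Qed.
Lemma shiftX : shift 'X = 'X + (q *: 'X + (q * e + c)%:P)%:P.
Proof. by rewrite /shift map_polyX comp_polyX. Qed.
Lemma unshiftX : unshift 'X = 'X - ('X + e%:P)%:P.
Proof. by rewrite /unshift map_polyX comp_polyX. Qed.

Lemma unshiftK : cancel unshift shift.
Proof.
apply: (poly2_morph_ext (F := shift \o unshift) (G := idfun)) => [k||] /=.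
- by rewrite unshiftC shiftC.
- rewrite unshiftP shiftP comp_polyX; congr _%:P.
  by rewrite comp_polyZ comp_polyB comp_polyX comp_polyC addrK scalerA mulVf // scale1r.
- rewrite unshiftX rmorphB /= shiftX shiftP comp_polyD comp_polyX comp_polyC.
  rewrite (_ : q *: 'X + g%:P + e%:P = q *: 'X + (q * e + c)%:P) ?addrK //.
  by rewrite -addrA -polyCD; congr (_ + _%:P); rewrite /g; ring.
Qed.

Lemma shiftK : cancel shift unshift.
Proof.
apply: (poly2_morph_ext (F := unshift \o shift) (G := idfun)) => [k||] /=.
- by rewrite shiftC unshiftC.
- rewrite shiftP unshiftP comp_polyX; congr _%:P.
  by rewrite comp_polyD comp_polyZ comp_polyX comp_polyC scalerA mulfV // scale1r subrK.
- rewrite shiftX rmorphD /= unshiftX unshiftP comp_polyD comp_polyZ comp_polyX comp_polyC.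
  rewrite scalerA mulfV // scale1r -addrA -polyCN -polyCD.
  rewrite (_ : - ('X + e%:P) + _ = 0) ?polyC0 ?addr0 //.
  apply/eqP; rewrite addrC subr_eq0 -addrA -polyCN -polyCD; apply/eqP.
  by congr (_ + _%:P); rewrite /g; ring.
Qed.

Definition shiftz (n : int) (P : D) : D :=
  if n is Negz m then iter m.+1 unshift P
  else iter `|n|%N shift P.

Lemma shiftzS n P : shiftz (n + 1) P = shift (shiftz n P).
Proof.
case: n => [n|[|n]].
- by rewrite (_ : n%:Z + 1 = n.+1%:Z) //; lia.
- by rewrite (_ : Negz 0 + 1 = 0) //= unshiftK.
- by rewrite (_ : Negz n.+1 + 1 = Negz n) /= ?unshiftK //; lia.
Qed.

Lemma shiftzN1 n P : shiftz (n - 1) P = unshift (shiftz n P).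
Proof. by rewrite -{2}[n](subrK 1) shiftzS shiftK. Qed.

Lemma int_ind2 (Q : int -> Prop) : Q 0 -> (forall n, Q n -> Q (n + 1)) ->
  (forall n, Q n -> Q (n - 1)) -> forall n, Q n.
Proof.
move=> Q0 QS QN; elim/int_rect => // n Qn.
  by rewrite -[n.+1]addn1 PoszD; apply: QS.
by rewrite -[n.+1]addn1 PoszD opprD; apply: QN.
Qed.

Lemma shiftz_comp m n P : shiftz m (shiftz n P) = shiftz (m + n) P.
Proof.
elim/int_ind2: m => [|m IHm|m IHm]; first by rewrite add0r.
  by rewrite addrAC !shiftzS IHm.
by rewrite addrAC !shiftzN1 IHm.
Qed.

Lemma shiftzB n P Q : shiftz n (P - Q) = shiftz n P - shiftz n Q.
Proof.
elim/int_ind2: n => // n IHn; first by rewrite !shiftzS IHn rmorphB.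
by rewrite !shiftzN1 IHn rmorphB.
Qed.
Lemma shiftz0 n : shiftz n 0 = 0.
Proof. by rewrite -[X in shiftz n X](subrr (0 : D)) shiftzB subrr. Qed.
Lemma shiftzD n P Q : shiftz n (P + Q) = shiftz n P + shiftz n Q.
Proof. by rewrite -{1}[Q]opprK -[- Q]sub0r !shiftzB shiftz0 sub0r opprK. Qed.
Lemma shiftzM n P Q : shiftz n (P * Q) = shiftz n P * shiftz n Q.
Proof.
elim/int_ind2: n => // n IHn; first by rewrite !shiftzS IHn rmorphM.
by rewrite !shiftzN1 IHn rmorphM.
Qed.
Lemma shiftz1 n : shiftz n 1 = 1.
Proof.
elim/int_ind2: n => // n IHn; first by rewrite !shiftzS IHn rmorph1.
by rewrite !shiftzN1 IHn rmorph1.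
Qed.

Lemma shiftzC n k : shiftz n k%:P%:P = k%:P%:P.
Proof.
elim/int_ind2: n => // n IHn; first by rewrite shiftzS IHn shiftC.
by rewrite shiftzN1 IHn unshiftC.
Qed.

Lemma shiftz_eq0 n P : (shiftz n P == 0) = (P == 0).
Proof.
apply/eqP/eqP => [P0|->]; last by rewrite shiftz0.
by rewrite -[P]/(shiftz 0 P) -(addNr n) -shiftz_comp P0 shiftz0.
Qed.

(** The eigenvalue of du in degree n of the module below. *)
Definition weight (n : int) : D := shiftz n 'X.

Lemma shiftz_weight m n : shiftz m (weight n) = weight (m + n).
Proof. exact: shiftz_comp. Qed.

Lemma weight_rec n :
  weight (n + 1) = (1 + q)%:P%:P * weight n - q%:P%:P * weight (n - 1) + c%:P%:P.
Proof.
have base : weight 1 = (1 + q)%:P%:P * weight 0 - q%:P%:P * weight (-1) + c%:P%:P.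
  rewrite /weight /= shiftX unshiftX !polyCD !polyCM -!mul_polyC !polyCM.
  rewrite !polyC1; ring.
have := congr1 (shiftz n) base.
by rewrite shiftzD shiftzB !shiftzM !shiftzC !shiftz_weight addr0.
Qed.

Lemma weight_neq0 n : weight n != 0.
Proof. by rewrite /weight shiftz_eq0 polyX_eq0. Qed.

(* weight n - q weight (n-1) is an arithmetic progression of step c. *)
Lemma weight_inj n : (forall m, (m.+1)%:R * c != 0) -> weight n = weight 0 -> n = 0.
Proof.
move=> char_c wn.
pose v m := weight m - q%:P%:P * weight (m - 1).
have vE m : v m = v 0 + (m%:~R * c)%:P%:P.
  elim/int_ind2: m => [|m IHm|m IHm].
  - by rewrite mul0r !polyC0 addr0.
  - have -> : v (m + 1) = v m + c%:P%:P.
      rewrite /v addrK weight_rec !polyCD !polyC1; ring.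
    by rewrite IHm intrD mulrDl mul1r !polyCD addrA.
  - have -> : v (m - 1) = v m - c%:P%:P.
      rewrite /v -[in weight m](subrK 1 m) weight_rec !polyCD !polyC1; ring.
    by rewrite IHm intrB mulrBl mul1r !polyCB addrA.
have : v n = v 0.
  rewrite /v wn; congr (_ - _ * _).
  by rewrite /weight !(addrC _ (-1)) -!shiftz_comp -/(weight n) -/(weight 0) wn.
rewrite vE => /eqP; rewrite -subr_eq0 addrAC subrr add0r !polyC_eq0.
case: n {wn} => [[|n]|n] //; first by rewrite (negPf (char_c n)).
by rewrite NegzE mulrNz mulNr oppr_eq0 (negPf (char_c n)).
Qed.

Lemma size_shift P : size (shift P) = size P.
Proof.
rewrite /shift size_comp_poly2 ?size_XaddC //.
apply: size_map_inj_poly; last by rewrite comp_poly0.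
have inj : injective (fun p : {poly K} => p%:P : D) by exact: polyC_inj.
by move=> x y xy; apply/inj/(can_inj shiftK); rewrite !shiftP; congr _%:P.
Qed.

Lemma lead_coef_shift P :
  lead_coef (shift P) = lead_coef P \Po (q *: 'X + g%:P).
Proof.
rewrite /shift lead_coef_comp ?size_XaddC // lead_coefXaddC expr1n mulr1.
rewrite lead_coef_map_inj ?comp_poly0 //.
have inj : injective (fun p : {poly K} => p%:P : D) by exact: polyC_inj.
by move=> x y xy; apply/inj/(can_inj shiftK); rewrite !shiftP; congr _%:P.
Qed.

End Shift.

(** * The graded weight module *)

Definition bands (K : fieldType) : Type := int -> {poly {poly K}}.
HB.instance Definition _ (K : fieldType) :=
  GRing.Zmodule.copy (bands K) (int -> {poly {poly K}}).

Section BandsModule.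
Variable K : fieldType.
Definition bands_scale (k : K) (v : bands K) : bands K := fun n => k%:P%:P * v n.
Lemma bands_scaleA k l v : bands_scale k (bands_scale l v) = bands_scale (k * l) v.
Proof. by apply/funext => n; rewrite /bands_scale mulrA -!polyCM. Qed.
Lemma bands_scale1 : left_id 1 bands_scale.
Proof. by move=> v; apply/funext => n; rewrite /bands_scale !polyC1 mul1r. Qed.
Lemma bands_scaleDr : right_distributive bands_scale +%R.
Proof. by move=> k v w; apply/funext => n; rewrite /bands_scale -mulrDr. Qed.
Lemma bands_scaleDl v : {morph bands_scale^~ v : k l / k + l}.
Proof. by move=> k l; apply/funext => n; rewrite /bands_scale !polyCD mulrDl. Qed.
HB.instance Definition _ := GRing.Zmodule_isLmodule.Build K (bands K)
  bands_scaleA bands_scale1 bands_scaleDr bands_scaleDl.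

Lemma bandsD (v w : bands K) n : (v + w) n = v n + w n. Proof. by []. Qed.
Lemma bandsN (v : bands K) n : (- v) n = - v n. Proof. by []. Qed.
Lemma bandsZ k (v : bands K) n : (k *: v) n = k%:P%:P * v n. Proof. by []. Qed.
Lemma bands_sum (I : Type) (r : seq I) (P : pred I) (F : I -> bands K) n :
  (\sum_(i <- r | P i) F i) n = \sum_(i <- r | P i) F i n.
Proof. by apply: (big_morph (fun v : bands K => v n)). Qed.

Definition pmul (P : {poly {poly K}}) (v : bands K) : bands K := fun n => P * v n.
Definition unitv (m : int) : bands K := fun n => (n == m)%:R.
End BandsModule.

Section WeightModule.
Variables (K : fieldType) (q c e : K).
Hypothesis q0 : q != 0.
Local Notation D := {poly {poly K}}.
Local Notation V := (bands K).
Local Notation weight := (weight q c e).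
Local Notation shiftz := (shiftz q c e).
Local Notation unitv := (@unitv K).

(** Here du acts in degree n by [weight n]. Degrees extend in both directions and y, k stay
    indeterminate, so no weight vanishes; faithfulness rests on this. *)
Definition weight_d (v : V) : V := fun n => weight n * v (n + 1).
Definition weight_u (v : V) : V := fun n => v (n - 1).

Lemma weight_d_linear : linear weight_d.
Proof.
move=> k v w; apply/funext => n; rewrite bandsD bandsZ /weight_d bandsD bandsZ.
by rewrite mulrDr mulrCA.
Qed.
HB.instance Definition _ := GRing.isLinear.Build K V V *:%R weight_d weight_d_linear.
Lemma weight_u_linear : linear weight_u.
Proof. by move=> k v w; apply/funext. Qed.
HB.instance Definition _ := GRing.isLinear.Build K V V *:%R weight_u weight_u_linear.

Lemma weight_rel : downup_relations (1 + q) (- q) c weight_d weight_u.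
Proof.
split=> v; apply/funext => n; rewrite !bandsD !bandsZ /weight_d /weight_u ?addrK ?subrK.
  by rewrite (weight_rec c e q0) !polyCN; ring.
by have := weight_rec c e q0 (n - 1); rewrite subrK => ->; rewrite !polyCN; ring.
Qed.

Variables (B : algType K) (d u : B).
Hypothesis dB : downup_algebra (1 + q) (- q) c d u.
Variable act : B -> {linear V -> V}.
Hypothesis acts : is_action d u weight_d weight_u act.

Lemma act_pmul z P v : act z (pmul P v) = pmul P (act z v).
Proof.
elim/(gen_ind dB): z => [|x y IHx IHy|k x IHx|x IHx|x IHx]; apply/funext => n.
- by rewrite !(act1 acts).
- by rewrite !(actD acts) !bandsD IHx IHy /pmul -mulrDr.
- by rewrite !(actZ acts) !bandsZ IHx /pmul mulrCA.
- by rewrite !(actM acts) !(act_d acts) IHx /= /weight_d /pmul mulrCA.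
- by rewrite !(actM acts) !(act_u acts) IHx.
Qed.

(** Moving degrees by m while shifting the entries m times commutes with d and u, because shifting a
    weight m times adds m to its index. Thus the action on [unitv 0] determines the action on every
    [unitv m]. *)
Definition translate (m : int) (v : V) : V := fun n => shiftz m (v (n - m)).

Lemma act_translate z m v : act z (translate m v) = translate m (act z v).
Proof.
elim/(gen_ind dB): z => [|x y IHx IHy|k x IHx|x IHx|x IHx]; apply/funext => n.
- by rewrite !(act1 acts).
- by rewrite !(actD acts) !bandsD IHx IHy /translate bandsD shiftzD.
- by rewrite !(actZ acts) !bandsZ IHx /translate bandsZ shiftzM // shiftzC.
- rewrite !(actM acts) !(act_d acts) IHx /= /weight_d /translate (shiftzM c e q0).
  by rewrite (shiftz_weight c e q0) [(m + (n - m))%R]addrC subrK [(n + 1 - m)%R]addrAC.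
- by rewrite !(actM acts) !(act_u acts) IHx /= /weight_u /translate addrAC.
Qed.

(** Serves as a normal form of z: finitely supported, and injective by [symb_inj]. *)
Definition symb (z : B) : V := act z (unitv 0).

Lemma translate_unitv m n : translate m (unitv n) = unitv (m + n).
Proof.
apply/funext => i; rewrite /translate /unitv subr_eq [n + m]addrC.
by case: eqP => _; rewrite ?shiftz1 ?shiftz0.
Qed.

Lemma act_unitv z m n : act z (unitv m) n = shiftz m (symb z (n - m)).
Proof. by rewrite -[m in LHS]addr0 -translate_unitv act_translate. Qed.

Definition fin_supp (v : V) : Prop := exists r : seq int, forall n, n \notin r -> v n = 0.

Lemma fin_supp_decomp v : fin_supp v ->
  exists2 r : seq int, uniq r & v = \sum_(m <- r) pmul (v m) (unitv m) /\
    forall n, n \notin r -> v n = 0.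
Proof.
case=> r rv; exists (undup r); first exact: undup_uniq.
split=> [|n]; last by rewrite mem_undup; apply: rv.
apply/funext => n; rewrite bands_sum; have [rn|nrn] := boolP (n \in undup r).
  rewrite (bigD1_seq n) ?undup_uniq //= /pmul /unitv eqxx mulr1 big1 ?addr0 // => m.
  by rewrite eq_sym => /negPf ->; rewrite mulr0.
rewrite rv; last by rewrite -mem_undup.
rewrite big_seq big1 // => m rm; rewrite /pmul /unitv.
by case: eqP => [nm|]; [rewrite nm rm in nrn|rewrite mulr0].
Qed.

Lemma fin_supp_symb z : fin_supp (symb z).
Proof.
rewrite /symb; elim/(gen_ind dB): z => [|x y [r rx] [s sy]|k x [r rx]|x [r rx]|x [r rx]].
- exists [:: 0] => n; rewrite inE (act1 acts) /unitv => /negPf -> //.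
- exists (r ++ s) => n; rewrite mem_cat => /norP[nr ns].
  by rewrite (actD acts) bandsD rx ?sy // addr0.
- by exists r => n nr; rewrite (actZ acts) bandsZ rx ?mulr0.
- exists [seq m - 1 | m <- r] => n nr; rewrite (actM acts) (act_d acts) /= /weight_d.
  rewrite rx ?mulr0 //; apply: contra nr => nr.
  by apply/mapP; exists (n + 1); rewrite ?addrK.
- exists [seq m + 1 | m <- r] => n nr; rewrite (actM acts) (act_u acts) /= /weight_u.
  rewrite rx //; apply: contra nr => nr.
  by apply/mapP; exists (n - 1); rewrite ?subrK.
Qed.

Lemma act_sumE z (r : seq int) v n : v = \sum_(m <- r) pmul (v m) (unitv m) ->
  act z v n = \sum_(m <- r) v m * shiftz m (symb z (n - m)).
Proof.
move=> vE; rewrite [v in LHS]vE linear_sum bands_sum; apply: eq_bigr => m _.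
by rewrite /= act_pmul /pmul act_unitv.
Qed.

(* s = 1 gives the highest degree of v, s = -1 the lowest one. *)
Definition extremal (s : int) (v : V) (m : int) : Prop :=
  v m != 0 /\ forall n, s * m < s * n -> v n = 0.

Lemma extremal_ex s v n : fin_supp v -> v n != 0 -> exists m, extremal s v m.
Proof.
case=> r rv vn; pose r' := [seq m <- r | v m != 0].
have nr' : n \in r'.
  by rewrite mem_filter vn /=; apply: contraT => /rv vn0; rewrite vn0 eqxx in vn.
have : forall t : seq int, t != [::] -> exists2 m, m \in t & forall i, i \in t -> s * i <= s * m.
  elim=> // x [|y t] IHt _; first by exists x; rewrite ?mem_head // => i; rewrite inE => /eqP ->.
  have [m mt hm] := IHt isT; have [le_mx|lt_xm] := lerP (s * m) (s * x).
    exists x; first exact: mem_head.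
    by move=> i; rewrite inE => /orP[/eqP -> //|/hm /le_trans]; apply.
  exists m; first by rewrite inE mt orbT.
  by move=> i; rewrite inE => /orP[/eqP ->|/hm //]; apply: ltW.
move=> /(_ r') [|m mr hm]; first by case: (r') nr'.
exists m; split=> [|i lt_mi]; first by move: mr; rewrite mem_filter => /andP[].
apply/eqP; apply: contraTT lt_mi => vi; rewrite -leNgt; apply: hm.
by rewrite mem_filter vi /=; apply: contraT => /rv vi0; rewrite vi0 eqxx in vi.
Qed.

(** Only one summand reaches the extremal degree, and it is a product of nonzero elements of the
    domain K[y,k]; so extremal degrees add. *)
Lemma extremal_act s z v m n : s != 0 -> fin_supp v ->
  extremal s (symb z) m -> extremal s v n -> extremal s (act z v) (m + n).
Proof.
move=> s0 vfin [zm0 zm] [vn0 vn]; have [r ur [vE rv]] := fin_supp_decomp vfin.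
have nr : n \in r by apply: contraT => /rv vn00; rewrite vn00 eqxx in vn0.
split=> [|i lt_i].
  rewrite (act_sumE _ _ vE) (bigD1_seq n) //= addrK big1 ?addr0 => [|j jn].
    by rewrite mulf_neq0 ?shiftz_eq0.
  have [lt_nj|le_jn] := ltrP (s * n) (s * j); first by rewrite vn // mul0r.
  rewrite zm ?shiftz0 ?mulr0 // !mulrDr mulrN.
  have : s * j != s * n by rewrite (inj_eq (mulfI s0)).
  lia.
rewrite (act_sumE _ _ vE) big1 // => j _.
have [lt_nj|le_jn] := ltrP (s * n) (s * j); first by rewrite vn // mul0r.
rewrite zm ?shiftz0 ?mulr0 //; move: lt_i; rewrite !mulrDr mulrN; lia.
Qed.

Lemma extremal_uniq s v m n : s != 0 -> extremal s v m -> extremal s v n -> m = n.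
Proof.
move=> s0 [vm0 vm] [vn0 vn]; apply: (mulfI s0); apply/eqP.
rewrite eq_le; apply/andP; split; rewrite leNgt; apply/negP => lt.
  by rewrite vn ?eqxx in vm0.
by rewrite vm ?eqxx in vn0.
Qed.

End WeightModule.

Lemma poly2_twisted (R : comNzRingType) (S : nzRingType)
    (F G : {rmorphism {poly {poly R}} -> S}) x :
    (forall k, F k%:P%:P * x = x * G k%:P%:P) -> F 'X%:P * x = x * G 'X%:P ->
    F 'X * x = x * G 'X -> forall P, F P * x = x * G P.
Proof.
move=> FGC FGy FGX; elim/poly_ind => [|P k IHP]; first by rewrite !rmorph0 mul0r mulr0.
rewrite !rmorphD !rmorphM /= mulrDl mulrDr -mulrA FGX mulrA IHP -!mulrA; congr (_ + _).
elim/poly_ind: k => [|k y IHk]; first by rewrite polyC0 !rmorph0 mul0r mulr0.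
rewrite polyCD polyCM !rmorphD !rmorphM /= mulrDl mulrDr FGC -!mulrA FGy mulrA.
by rewrite IHk -!mulrA.
Qed.

(** * Spanning monomials and faithfulness *)

Section Faithful.
Variables (K : fieldType) (q c e : K).
Hypothesis q0 : q != 0.
Local Notation D := {poly {poly K}}.
Local Notation V := (bands K).
Local Notation weight := (weight q c e).
Local Notation shiftz := (shiftz q c e).
Local Notation unitv := (@unitv K).
Variables (B : algType K) (d u : B).
Hypothesis dB : downup_algebra (1 + q) (- q) c d u.
Variable act : B -> {linear V -> V}.
Hypothesis acts : is_action d u (weight_d q c e) (weight_u (K := K)) act.
Local Notation symb := (symb act).

Definition wnormal : B := d * u - u * d - e *: 1.
Local Notation w := wnormal.

(** One product is (d u^2) d, the other u (d^2 u), and the two relations expand them to the same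
    element. *)
Lemma comm_du_ud : GRing.comm (d * u) (u * d).
Proof.
rewrite /GRing.comm.
have -> : d * u * (u * d) = d * u ^+ 2 * d by rewrite expr2 !mulrA.
have -> : u * d * (d * u) = u * (d ^+ 2 * u) by rewrite expr2 !mulrA.
rewrite (rel_d dB) (rel_u dB) !mulrDl !mulrDr -!scalerAl -!scalerAr.
by rewrite !expr2 !mulrA.
Qed.

Lemma comm_du_w : GRing.comm (d * u) w.
Proof.
apply: commrB; last by apply/commr_sym; rewrite /GRing.comm -scalerAl -scalerAr mul1r mulr1.
by apply: commrB; [exact: commr_refl|exact: comm_du_ud].
Qed.

Lemma comm_horner_alg : commr_rmorph (horner_alg w) (d * u).
Proof.
move=> p; elim/poly_ind: p => [|p k IHp]; first by rewrite rmorph0; apply: commr0.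
rewrite rmorphD rmorphM /= horner_algX horner_algC; apply: commrD.
  by apply: commrM => //; apply: comm_du_w.
by rewrite /GRing.comm -scalerAl -scalerAr mul1r mulr1.
Qed.

(** Sends y to w and k to du; these commute, and polynomials in them are the coefficients of the
    monomials in [pbw_span]. *)
Definition ev : D -> B := horner_morph comm_horner_alg.
HB.instance Definition _ := GRing.RMorphism.copy ev (horner_morph comm_horner_alg).

Lemma evX : ev 'X = d * u. Proof. exact: horner_morphX. Qed.
Lemma evP p : ev p%:P = horner_alg w p. Proof. exact: horner_morphC. Qed.
Lemma evC k : ev k%:P%:P = k *: 1. Proof. by rewrite evP horner_algC. Qed.
Lemma evy : ev 'X%:P = w. Proof. by rewrite evP horner_algX. Qed.

Lemma ev_unshiftX : ev (unshift q c e 'X) = u * d.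
Proof.
rewrite unshiftX polyCD rmorphB rmorphD /= evX evy evC /w.
by rewrite subrK opprB addrC subrK.
Qed.

Lemma ev_shift_linear k l : ev (k *: 'X + l%:P)%:P = k *: w + l *: 1.
Proof.
rewrite evP -mul_polyC rmorphD rmorphM /= !horner_algC horner_algX.
by rewrite -scalerAl mul1r.
Qed.

Lemma scale1_comm k (x : B) : k *: 1 * x = x * (k *: 1).
Proof. by rewrite -scalerAl -scalerAr mul1r mulr1. Qed.

Lemma du_rel_u : d * u * u = (1 + q) *: (u * d * u) - q *: (u * u * d) + c *: u.
Proof. by rewrite -mulrA -expr2 (rel_u dB) scaleNr expr2. Qed.

Lemma du_rel_d : d * d * u = (1 + q) *: (d * u * d) - q *: (u * d * d) + c *: d.
Proof. by rewrite -expr2 (rel_d dB) scaleNr expr2 [u * (d * d)]mulrA. Qed.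

Let g := c - (1 - q) * e.

Lemma linear_combination_w (M : lmodType K) (x y z : M) :
  (1 + q) *: x - q *: y + c *: z - x - e *: z = q *: (x - y - e *: z) + g *: z.
Proof.
have -> : g *: z = q *: (e *: z) + (c *: z - e *: z).
  by rewrite scalerA -scalerBl -scalerDl; congr (_ *: _); rewrite /g; ring.
rewrite !scalerBr scalerDl scale1r addrA subrK addrA; congr (_ - _).
by rewrite -!addrA [LHS]addrC !addrA subrK.
Qed.

Lemma w_u : w * u = q *: (u * w) + g *: u.
Proof.
rewrite /w !mulrBl !mulrBr !mulrA -scalerAl -scalerAr mul1r mulr1 du_rel_u.
exact: linear_combination_w.
Qed.

Lemma d_w : d * w = q *: (w * d) + g *: d.
Proof.
rewrite /w !mulrBl !mulrBr !mulrA -scalerAl -scalerAr mul1r mulr1 du_rel_d.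
exact: linear_combination_w.
Qed.

Lemma ev_u P : ev P * u = u * ev (shift q c e P).
Proof.
apply: (poly2_twisted (F := ev) (G := ev \o shift q c e)) => [k||] /=.
- by rewrite shiftC evC scale1_comm.
- by rewrite shiftP comp_polyX ev_shift_linear evy w_u [RHS]mulrDr -!scalerAr mulr1.
- rewrite shiftX rmorphD /= ev_shift_linear evX mulrDr du_rel_u.
  rewrite mulrDr -!scalerAr mulr1 /w !mulrBr mulrA mulrA -scalerAr mulr1.
  rewrite !scalerBr scalerDl scale1r scalerA scalerDl !addrA; congr (_ + _).
  by rewrite subrK.
Qed.

Lemma ev_d P : ev P * d = d * ev (unshift q c e P).
Proof.
apply: (poly2_twisted (F := ev) (G := ev \o unshift q c e)) => [k||] /=.
- by rewrite unshiftC evC scale1_comm.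
- rewrite unshiftP comp_polyX.
  have -> : q^-1 *: ('X - g%:P) = q^-1 *: 'X + (- (q^-1 * g))%:P.
    by rewrite scalerBr polyCN polyCM mul_polyC.
  rewrite ev_shift_linear evy [RHS]mulrDr -!scalerAr mulr1 d_w scalerDr !scalerA mulVf //.
  by rewrite scale1r -addrA -scalerDl subrr scale0r addr0.
- by rewrite ev_unshiftX evX mulrA.
Qed.

(** One monomial per degree: mixed words are absorbed into the coefficients, since ud and du both
    lie in the image of [ev]. *)
Definition mon (n : int) : B := if n is Negz m then d ^+ m.+1 else u ^+ `|n|%N.

Lemma mon_opp i : mon (- i%:Z) = d ^+ i.
Proof. by case: i. Qed.

Lemma ev_uX P i : ev P * u ^+ i = u ^+ i * ev (shiftz i P).
Proof.
elim: i P => [|i IHi] P; first by rewrite !expr0 mulr1 mul1r.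
rewrite exprS mulrA ev_u -mulrA IHi mulrA.
by rewrite -[shift q c e P]/(shiftz 1 P) shiftz_comp // -[i.+1]addn1 PoszD.
Qed.

Lemma ev_dX P i : ev P * d ^+ i = d ^+ i * ev (shiftz (- i%:Z) P).
Proof.
elim: i P => [|i IHi] P; first by rewrite !expr0 mulr1 mul1r.
rewrite exprS mulrA ev_d -mulrA IHi mulrA.
by rewrite -[unshift q c e P]/(shiftz (-1) P) shiftz_comp // -[i.+1]addn1 PoszD opprD.
Qed.

Lemma u_mon n : exists P, u * mon n = mon (n + 1) * ev P.
Proof.
case: n => [i|i].
  by exists 1; rewrite rmorph1 mulr1 -exprS -[X in _ = mon X]/((i%:Z + 1)%R) addrC.
exists (shiftz (- i%:Z) (unshift q c e 'X)).
have -> : Negz i + 1 = - i%:Z by lia.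
by rewrite mon_opp /= exprS mulrA -ev_unshiftX ev_dX.
Qed.

Lemma d_mon n : exists P, d * mon n = mon (n - 1) * ev P.
Proof.
case: n => [[|i]|i].
- by exists 1; rewrite rmorph1 [RHS]mulr1; exact: mulr1.
- exists (shiftz i 'X); have -> : i.+1%:Z - 1 = i%:Z by lia.
  by rewrite /= exprS mulrA -evX ev_uX.
exists 1; have -> : Negz i - 1 = Negz i.+1 by lia.
by rewrite rmorph1 mulr1 /= -exprS.
Qed.

Lemma pbw_span z : exists s : seq (int * D), z = \sum_(p <- s) mon p.1 * ev p.2.
Proof.
have shift_span (x : B) (k : int) : (forall n, exists P, x * mon n = mon (n + k) * ev P) ->
    forall s : seq (int * D), exists s' : seq (int * D),
      x * (\sum_(p <- s) mon p.1 * ev p.2) = \sum_(p <- s') mon p.1 * ev p.2.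
  move=> hx; elim=> [|[n P] s [s' sE]]; first by exists [::]; rewrite !big_nil mulr0.
  have [Q QE] := hx n; exists ((n + k, Q * P) :: s').
  by rewrite !big_cons /= mulrDr sE mulrA QE rmorphM mulrA.
elim/(gen_ind dB): z => [|x y [s ->] [s' ->]|k x [s ->]|x [s ->]|x [s ->]].
- by exists [:: (0, 1)]; rewrite big_seq1 /= expr0 rmorph1 mulr1.
- by exists (s ++ s'); rewrite big_cat.
- exists [seq (p.1, k%:P%:P * p.2) | p <- s]; rewrite big_map scaler_sumr.
  by apply: eq_bigr => p _; rewrite /= rmorphM /= evC -scalerAl mul1r scalerAr.
- exact: shift_span d_mon s.
- exact: shift_span u_mon s.
Qed.

(** In degree 0, du has eigenvalue k and ud has eigenvalue k - y - e, so w has eigenvalue y and a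
    polynomial acts by itself. *)
Lemma act_ev P : act (ev P) (unitv 0) = pmul P (unitv 0).
Proof.
have act_du v : act (d * u) v = fun n => weight n * v n.
  rewrite (actM acts) (act_d acts) (act_u acts) /= /weight_d /weight_u.
  by apply/funext => n; rewrite addrK.
have act_ud v : act (u * d) v = fun n => weight (n - 1) * v n.
  rewrite (actM acts) (act_d acts) (act_u acts) /= /weight_d /weight_u.
  by apply/funext => n; rewrite subrK.
have act_w v : act w v = fun n => (weight n - weight (n - 1) - e%:P%:P) * v n.
  rewrite /w !(actB acts) (actZ acts) (act1 acts) act_du act_ud; apply/funext => n.
  by rewrite !bandsD !bandsN bandsZ !mulrBl.
have pmulD (Q R : D) (v : V) : pmul (Q + R) v = pmul Q v + pmul R v.
  by apply/funext => n; rewrite bandsD /pmul mulrDl.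
have step x Q R : act x (unitv 0) = pmul Q (unitv 0) ->
    act (ev R) (unitv 0) = pmul R (unitv 0) ->
    act (ev R * x) (unitv 0) = pmul (R * Q) (unitv 0).
  move=> xE RE; rewrite (actM acts) xE (act_pmul dB acts) RE.
  by apply/funext => n; rewrite /pmul mulrCA mulrA.
elim/poly_ind: P => [|P k IHP].
  rewrite rmorph0 (act0 acts); apply/funext => n.
  by rewrite /pmul mul0r.
rewrite rmorphD (actD acts) pmulD rmorphM /= evX; congr (_ + _).
  apply: step => //; rewrite act_du; apply/funext => n; rewrite /pmul /unitv.
  by case: eqP => [->|]; rewrite ?mulr0 // mulr1.
elim/poly_ind: k => [|k x IHk].
  rewrite polyC0 rmorph0 (act0 acts); apply/funext => n.
  by rewrite /pmul mul0r.
rewrite polyCD polyCM rmorphD (actD acts) pmulD rmorphM /= evy; congr (_ + _).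
  apply: step => //; rewrite act_w; apply/funext => n; rewrite /pmul /unitv.
  case: eqP => [->|]; rewrite ?mulr0 // !mulr1.
  by rewrite sub0r /weight /= unshiftX polyCD; ring.
by rewrite evC (actZ acts) (act1 acts); apply/funext => n.
Qed.

Lemma act_mon n : exists2 g, g != 0 & act (mon n) (unitv 0) = pmul g (unitv n).
Proof.
case: n => i.
  exists 1; first exact: oner_neq0.
  elim: i => [|i IHi]; apply/funext => n; first by rewrite (act1 acts) /pmul mul1r.
  rewrite /= exprS (actM acts) -[u ^+ i]/(mon i) IHi (act_u acts) /= /weight_u /pmul.
  by rewrite /unitv subr_eq -PoszD addn1.
elim: i => [|i [g' g0 IHi]].
  exists (weight (-1)); first exact: weight_neq0.
  apply/funext => n; rewrite /= expr1 (act_d acts) /= /weight_d /unitv /pmul.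
  by rewrite addr_eq0; case: eqP => [->|]; rewrite ?mulr0.
exists (weight (Negz i.+1) * g'); first by rewrite mulf_neq0 ?weight_neq0.
apply/funext => n; rewrite /= exprS (actM acts) -[d ^+ i.+1]/(mon (Negz i)) IHi.
rewrite (act_d acts) /= /weight_d /unitv /pmul.
have -> : (n + 1 == Negz i) = (n == Negz i.+1) by lia.
by case: eqP => [->|]; rewrite ?mulr0 ?mulr1.
Qed.

(** Group a spanning expression of z by degree: the component of the symbol in degree n is the total
    coefficient times a nonzero polynomial, so every coefficient vanishes. *)
Lemma symb_inj z : symb z = 0 -> z = 0.
Proof.
have [s ->] := pbw_span z => z0.
pose G n := act (mon n) (unitv 0) n.
have G0 n : G n != 0.
  by have [g' g0 E] := act_mon n; rewrite /G E /pmul /unitv eqxx mulr1.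
have GE n : act (mon n) (unitv 0) = pmul (G n) (unitv n).
  by have [g' g0 E] := act_mon n; rewrite /G E /pmul /unitv eqxx mulr1.
pose C n : D := \sum_(p <- s | p.1 == n) p.2.
have C0 n : C n = 0.
  apply: (mulIf (G0 n)); rewrite mul0r.
  transitivity (symb (\sum_(p <- s) mon p.1 * ev p.2) n); last by rewrite z0.
  rewrite /symb (act_sum acts) bands_sum /C mulr_suml big_mkcond; apply: eq_bigr => p _.
  rewrite (actM acts) act_ev (act_pmul dB acts) GE /pmul /unitv eq_sym.
  by case: eqP => [->|]; rewrite ?mulr1 ?mulr0.
transitivity (\sum_(n <- undup (unzip1 s)) mon n * ev (C n)); last first.
  by rewrite big1 // => n _; rewrite C0 rmorph0 mulr0.
under [RHS]eq_bigr do rewrite rmorph_sum mulr_sumr.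
rewrite (exchange_big_dep xpredT) //= [LHS]big_seq [RHS]big_seq; apply: eq_bigr => p ps.
have pr : p.1 \in undup (unzip1 s) by rewrite mem_undup; apply: map_f.
rewrite [RHS]big_mkcond (bigD1_seq p.1) ?undup_uniq //= eqxx big1 ?addr0 // => n.
by rewrite eq_sym => /negPf ->.
Qed.

End Faithful.

Lemma coef_comp_scaleX (R : comNzRingType) (p : {poly R}) k j :
  (p \Po (k *: 'X))`_j = k ^+ j * p`_j.
Proof.
rewrite comp_polyE coef_sum.
under eq_bigr do rewrite exprZn !coefZ coefXn.
have [lt_j|le_j] := ltnP j (size p).
  rewrite (bigD1 (Ordinal lt_j)) //= eqxx mulr1 mulrC big1 ?addr0 // => i.
  by rewrite -val_eqE /= eq_sym => /negPf ->; rewrite !mulr0.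
rewrite nth_default // mulr0 big1 // => i _.
by rewrite gtn_eqF ?mulr0 // (leq_trans (ltn_ord i)).
Qed.

(** * Eigenvectors of the shift *)

Section ShiftEigen.
Variables (K : fieldType) (q c e : K).
Hypothesis q0 : q != 0.
Local Notation D := {poly {poly K}}.
Local Notation sh := (shift q c e).

Lemma deriv_shift P : (sh P)^`() = sh P^`().
Proof.
rewrite /shift deriv_comp derivD derivX derivC addr0 mulr1.
by rewrite deriv_map.
Qed.

Lemma derivn_shift n P : (sh P)^`(n) = sh P^`(n).
Proof. by elim: n => // n IHn; rewrite !derivnS IHn deriv_shift. Qed.

(** The shift preserves the degree in k and the degree in y of the leading coefficient, which leaves
    no room for a nonconstant factor. *)
Lemma eigen_const P X : P != 0 -> sh P = P * X ->
  exists2 s : K, s != 0 & X = s%:P%:P.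
Proof.
move=> P0 PX; have X0 : X != 0.
  apply: contraNneq P0 => X0; rewrite -size_poly_eq0 -(size_shift c e q0).
  by rewrite PX X0 mulr0 size_poly0.
have size1 (R : idomainType) (x y : {poly R}) : x != 0 -> y != 0 ->
    size (x * y) = size x -> exists2 k, k != 0 & y = k%:P.
  move=> x0 y0; rewrite size_mul // => sx.
  have /size_poly1P[k k0 yE] : size y == 1%N.
    have := sx; move: x0 y0; rewrite -!size_poly_gt0; lia.
  by exists k.
have [x x0 XE] : exists2 k, k != 0 & X = k%:P.
  by apply: (size1 _ P) => //; rewrite -PX size_shift.
have [s s0 xE] : exists2 k, k != 0 & x = k%:P.
  apply: (size1 _ (lead_coef P)); rewrite ?lead_coef_eq0 //.
  have := congr1 lead_coef PX; rewrite lead_coef_shift // lead_coefM XE lead_coefC.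
  move=> <-; rewrite size_comp_poly2 // size_polyDl ?size_scale ?size_polyX //.
  by rewrite size_polyC; case: eqP.
by exists s; rewrite // XE xE.
Qed.

(** For q = 1 both substitutions are monic, so the leading coefficient of the leading coefficient is
    fixed. *)
Lemma eigen_q1 P s : q = 1 -> P != 0 -> sh P = P * s%:P%:P -> s = 1.
Proof.
move=> q1 P0 /(congr1 lead_coef); rewrite lead_coef_shift // lead_coefM lead_coefC.
move=> /(congr1 lead_coef); rewrite lead_coefM lead_coefC lead_coef_comp; last first.
  by rewrite q1 scale1r size_XaddC.
rewrite q1 scale1r lead_coefXaddC expr1n mulr1 -[LHS]mulr1 => /mulfI ->//.
by rewrite !lead_coef_eq0.
Qed.

Hypotheses (q1 : q != 1) (cE : c = (1 - q) * e) (e0 : e != 0).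
Hypothesis char0 : forall m, m.+1%:R != 0 :> K.

Lemma shift_diag (p : {poly K}) j s : sh p%:P = p%:P * s%:P%:P ->
  q ^+ j * p`_j = s * p`_j.
Proof.
rewrite shiftP cE subrr polyC0 addr0 -polyCM => /polyC_inj /(congr1 (fun r : {poly K} => r`_j)).
by rewrite coef_comp_scaleX coefMC mulrC => ->; rewrite mulrC.
Qed.

(** The k-coefficient makes p an eigenvector of y |-> q y, hence supported in degrees j with q^j =
    s. The other coefficient, taken in degree j = deg p, reads s e p_j = 0 once the term in p_(j-1)
    is removed. *)
Lemma eigen_size2 (p r : {poly K}) s : s != 0 ->
  sh (p%:P * 'X + r%:P) = (p%:P * 'X + r%:P) * s%:P%:P -> p = 0.
Proof.
move=> s0; rewrite rmorphD rmorphM /= !shiftP shiftX.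
rewrite cE subrr polyC0 addr0 (_ : q * e + (1 - q) * e = e); last by ring.
move=> E; have E1 := congr1 (fun P : D => P`_1) E.
have E0 := congr1 (fun P : D => P`_0) E; move: E1 E0 => {E}.
rewrite mulrDr -polyCM -addrA -polyCD mulrDl -mulrA ['X * _]mulrC mulrA -!polyCM.
rewrite !coefD !coefMX !coefC /= !addr0 !add0r => E1 E0.
apply/eqP; apply: contraT => p0; exfalso.
have coefp j : q ^+ j * p`_j = s * p`_j.
  by rewrite -coef_comp_scaleX E1 coefMC mulrC.
have lp : p`_(size p).-1 != 0 by rewrite -/(lead_coef p) lead_coef_eq0.
set j := (size p).-1 in lp.
have sj : s = q ^+ j by apply: (mulIf lp); rewrite coefp.
have := congr1 (fun p : {poly K} => p`_j) E0; rewrite coefD coefMC mulrDr coefD.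
rewrite coefMC -scalerAr coefZ coefMX !coef_comp_scaleX -sj.
(* A nonzero p_(j-1) would give q^(j-1) = s = q^j, impossible for q different from 0 and 1. *)
have -> : (if (j == 0)%N then 0 else q ^+ j.-1 * p`_j.-1) = 0.
  case: (j) sj => //= i si; rewrite coefp; apply/eqP; rewrite mulf_eq0 (negPf s0) /=.
  apply: contraT => pi; have := coefp i; rewrite si exprS => /(mulIf pi) /eqP.
  rewrite eq_sym -subr_eq0 -[X in _ - X]mul1r -mulrBl mulf_eq0 subr_eq0 (negPf q1) /=.
  by rewrite expf_eq0 (negPf q0) andbF.
rewrite mulr0 add0r [r`_j * s]mulrC => /(canRL (addrK _)); rewrite subrr => /eqP.
by rewrite !mulf_eq0 (negPf s0) (negPf lp) (negPf e0).
Qed.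

(* Derivation in k commutes with the shift, which reduces to degree 1 in k. *)
Lemma eigen_size P s : s != 0 -> sh P = P * s%:P%:P -> (size P <= 1)%N.
Proof.
move=> s0 PE; rewrite leqNgt; apply/negP => ltP.
have [n sPn] : exists n, size P = n.+2.
  by exists (size P).-2; case: (size P) ltP => [|[]].
pose Q := P^`(n).
have QE : sh Q = Q * s%:P%:P.
  rewrite /Q -derivn_shift PE mulrC; apply/polyP => i.
  by rewrite !(coef_derivn, coefCM, coefMC) -mulrnAr mulrC.
have Q2 : Q = (Q`_1)%:P * 'X + (Q`_0)%:P.
  apply/polyP => -[|[|i]]; rewrite coefD coefMX !coefC /= ?addr0 ?add0r //.
  by rewrite coef_derivn nth_default ?mul0rn // sPn !addnS !ltnS leq_addr.
rewrite Q2 in QE; have := eigen_size2 s0 QE; rewrite coef_derivn => /eqP.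
have -> : (n + 1)%N = (size P).-1 by rewrite sPn addn1.
have lP : P`_(size P).-1 != 0.
  by rewrite -/(lead_coef P) lead_coef_eq0 -size_poly_gt0 (ltn_trans _ ltP).
have : (0 < (size P).-1 ^_ n)%N by rewrite ffact_gt0 sPn.
case: (_ ^_ _)%N => // m _; rewrite -mulr_natr mulf_eq0 (negPf lP) /=.
by rewrite -polyC_natr polyC_eq0 (negPf (char0 m)).
Qed.

End ShiftEigen.

(** * Normal elements *)

Definition normal_elt (R : nzRingType) (x : R) : Prop :=
  forall z, exists z', x * z = z' * x.

Lemma trivial_char (K : fieldType) (a b c : K) (B : algType K) (d u : B) :
    downup_algebra a b c d u ->
  exists chi : {lrmorphism B -> K^o}, chi d = 0 /\ chi u = 0.
Proof.
move=> dB; apply: (universal_lift dB (B := K^o));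
  by rewrite !expr2 !(mul0r, mulr0, scaler0, addr0).
Qed.

Section NormalElements.
Variables (K : fieldType) (q c e : K).
Hypothesis q0 : q != 0.
Local Notation D := {poly {poly K}}.
Local Notation V := (bands K).
Local Notation weight := (weight q c e).
Local Notation shift := (shift q c e).
Local Notation shiftz := (shiftz q c e).
Local Notation unitv := (@unitv K).
Variables (B : algType K) (d u : B).
Hypothesis dB : downup_algebra (1 + q) (- q) c d u.
Variable act : B -> {linear V -> V}.
Hypothesis acts : is_action d u (weight_d q c e) (weight_u (K := K)) act.
Local Notation symb := (symb act).

(** At k = 0, y = -e the weights in degrees 0 and -1 vanish, so d carries nothing into these degrees
    and degree 0 sees the trivial character. The induction includes the vanishing of negative
    components because u raises degree -1 to degree 0. *)
Lemma symb_at_point z (chi : {lrmorphism B -> K^o}) : chi d = 0 -> chi u = 0 ->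
  chi z = (symb z 0).[0].[- e].
Proof.
move=> chi_d chi_u; pose at0 (P : D) : K := P.[0].[- e].
have w0 : at0 (weight 0) = 0 by rewrite /at0 /weight /= hornerX horner0.
have wN1 : at0 (weight (-1)) = 0.
  by rewrite /at0 /weight /= unshiftX !hornerE addrC subrr oppr0.
suff [] : chi z = at0 (symb z 0) /\ forall m : nat, at0 (symb z (Negz m)) = 0 by [].
rewrite /symb; elim/(gen_ind dB): z => [|x y [x0 xN] [y0 yN]|k x [x0 xN]|x [x0 xN]|x [x0 xN]].
- rewrite (act1 acts) rmorph1 /at0 /unitv /=; split=> [|m]; first by rewrite !hornerC.
  by rewrite mulr0n !horner0.
- rewrite rmorphD /= x0 y0 (actD acts); split=> [|m]; rewrite /at0 bandsD !hornerD //.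
  by rewrite -/(at0 _) xN -/(at0 _) yN addr0.
- rewrite linearZ /= x0 (actZ acts); split=> [|m]; rewrite /at0 bandsZ !hornerE //.
  by rewrite -/(at0 _) xN mulr0.
- rewrite rmorphM /= chi_d mul0r (actM acts) (act_d acts) /= /weight_d.
  split=> [|[|m]]; rewrite /at0 !hornerM -!/(at0 _) ?w0 ?wN1 ?mul0r //.
  have -> : Negz m.+1 + 1 = Negz m by lia.
  by rewrite xN mulr0.
rewrite rmorphM /= chi_u mul0r (actM acts) (act_u acts) /= /weight_u.
split=> [|m]; first by rewrite -[0 - 1]/(Negz 0) xN.
have -> : Negz m - 1 = Negz m.+1 by lia.
exact: xN.
Qed.

Variable W : B.
Hypothesis W_normal : normal_elt W.
Hypothesis W0 : symb W 0 != 0.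
Hypothesis char_c : forall m, m.+1%:R * c != 0.

Lemma act_du v n : act (d * u) v n = weight n * v n.
Proof. by rewrite (actM acts) (act_d acts) (act_u acts) /= /weight_d /weight_u addrK. Qed.

Lemma symb_W_du n : symb (W * (d * u)) n = weight 0 * symb W n.
Proof.
rewrite {1}/symb (actM acts).
have -> : act (d * u) (unitv 0) = pmul (weight 0) (unitv 0).
  apply/funext => m; rewrite act_du /pmul /unitv.
  by case: eqP => [->|]; rewrite ?mulr0.
by rewrite (act_pmul dB acts).
Qed.

(* Comparing the extremal degrees of both sides of W (du) = z W shows that z has
   degree 0, and then W (du) = z W forces weight n = weight 0 in each degree n of W. *)
Lemma normal_homogeneous n : n != 0 -> symb W n = 0.
Proof.
have [z zE] := W_normal (d * u).
have symb_z m : weight 0 * symb W m = act z (symb W) m.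
  by rewrite -symb_W_du zE {1}/symb (actM acts).
have finW := fin_supp_symb dB acts W.
have z0 : exists m, symb z m != 0.
  apply/not_existsP => sz0; have := symb_z 0.
  have [r _ [vE _]] := fin_supp_decomp finW.
  rewrite (act_sumE q0 dB acts _ _ vE) big1 => [/eqP|i _].
    by rewrite mulf_eq0 (negPf W0) (negPf (weight_neq0 c e q0 0)).
  have /negP := sz0 (0 - i); rewrite negbK => /eqP ->.
  by rewrite shiftz0 // mulr0.
have deg0 s : s != 0 -> extremal s (symb z) 0.
  move=> s0; have [i zi] := z0.
  have [m zm] := extremal_ex s (fin_supp_symb dB acts z) zi.
  have [l Wl] := extremal_ex s finW W0.
  have ext1 := extremal_act q0 dB acts s0 finW zm Wl.
  have ext2 : extremal s (act z (symb W)) l.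
    case: Wl => Wl0 Wl; split=> [|j lj]; rewrite -symb_z; last by rewrite Wl ?mulr0.
    by rewrite mulf_neq0 ?weight_neq0.
  have := extremal_uniq s0 ext1 ext2.
  by move=> ml; move: zm; have -> : m = 0 by lia.
have symbz m : m != 0 -> symb z m = 0.
  have [[_ top] [_ bot]] := (deg0 1 isT, deg0 (-1) isT).
  by move=> m0; have [lt_m|lt_m|m00] := ltgtP m 0;
    [apply: bot; lia|apply: top; lia|rewrite m00 eqxx in m0].
have act_z m : weight 0 * symb W m = symb W m * shiftz m (symb z 0).
  rewrite symb_z; have [r ur [vE rv]] := fin_supp_decomp finW.
  rewrite (act_sumE q0 dB acts _ _ vE); have [mr|mr] := boolP (m \in r).
    rewrite (bigD1_seq m) //= subrr big1 ?addr0 // => i im.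
    by rewrite symbz ?shiftz0 ?mulr0 // subr_eq0 eq_sym.
  rewrite rv // mul0r big_seq big1 // => i ir; rewrite symbz ?shiftz0 ?mulr0 //.
  by rewrite subr_eq0; apply: contraNneq mr => ->.
have zw : symb z 0 = weight 0.
  by apply: (mulfI W0); rewrite mulrC [RHS]mulrC act_z mulrC.
apply: contraNeq => Wn; apply/eqP; apply: (weight_inj q0 char_c).
have := act_z n; rewrite zw shiftz_weight // addr0 mulrC => /(mulfI Wn) wn.
exact: esym wn.
Qed.

Lemma symb_W : symb W = pmul (symb W 0) (unitv 0).
Proof.
apply/funext => n; rewrite /pmul /unitv; case: eqP => [->|/eqP n0]; rewrite ?mulr1 //.
by rewrite normal_homogeneous // mulr0.
Qed.

Lemma symb_Wu n : symb (W * u) n = shift (symb W (n - 1)).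
Proof.
rewrite {1}/symb (actM acts) (act_u acts).
have -> : weight_u (unitv 0) = unitv 1.
  by apply/funext => m; rewrite /weight_u /unitv subr_eq add0r.
by rewrite (act_unitv q0 dB acts).
Qed.

Lemma symb_Wd n : symb (W * d) n = weight (-1) * unshift q c e (symb W (n + 1)).
Proof.
rewrite {1}/symb (actM acts) (act_d acts).
have -> : weight_d q c e (unitv 0) = pmul (weight (-1)) (unitv (-1)).
  apply/funext => m; rewrite /= /weight_d /pmul /unitv addr_eq0.
  by case: eqP => [->|]; rewrite ?mulr0.
by rewrite (act_pmul dB acts) /pmul (act_unitv q0 dB acts) opprK.
Qed.

(** Read Wu = zW in degree 1: as W has degree 0, its symbol divides its own shift. *)
Lemma normal_eigen : exists2 s : K, s != 0 & shift (symb W 0) = symb W 0 * s%:P%:P.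
Proof.
have [z zE] := W_normal u.
have E : shift (symb W 0) = symb W 0 * symb z 1.
  rewrite -[in LHS](subrr 1) -symb_Wu zE {1}/symb (actM acts) -/(symb W) symb_W.
  by rewrite (act_pmul dB acts) /pmul /unitv eqxx mulr1.
have [s s0 sE] := eigen_const q0 W0 E.
by exists s; rewrite // E sE.
Qed.

(** The eigenvalue is 1, so the symbol is invariant under the shift, and by faithfulness W commutes
    with d and u. *)
Lemma normal_central : q = 1 -> forall z, GRing.comm z W.
Proof.
move=> q1; have [s s0 sE] := normal_eigen.
have s1 := eigen_q1 q0 q1 W0 sE; rewrite s1 !polyC1 mulr1 in sE.
have sE' : unshift q c e (symb W 0) = symb W 0 by rewrite -[in LHS]sE shiftK.
have Wu : u * W = W * u.
  apply/eqP; rewrite -subr_eq0; apply/eqP/(symb_inj q0 dB acts); apply/funext => n.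
  rewrite {1}/symb (actB acts) bandsD bandsN -!/(symb _) symb_Wu.
  rewrite {1}/symb (actM acts) (act_u acts) /= /weight_u -/(symb W).
  have [->|n1] := eqVneq n 1; first by rewrite subrr sE subrr.
  by rewrite normal_homogeneous ?subr_eq0 // rmorph0 subrr.
have Wd : d * W = W * d.
  apply/eqP; rewrite -subr_eq0; apply/eqP/(symb_inj q0 dB acts); apply/funext => n.
  rewrite {1}/symb (actB acts) bandsD bandsN -!/(symb _) symb_Wd.
  rewrite {1}/symb (actM acts) (act_d acts) /= /weight_d -/(symb W).
  have [->|n1] := eqVneq n (-1); first by rewrite addNr sE' subrr.
  by rewrite normal_homogeneous ?addr_eq0 // rmorph0 !mulr0 subrr.
exact: (comm_gen dB (f := idfun)).
Qed.

(** [eigen_size] removes k from the symbol, and faithfulness turns the remaining polynomial in y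
    into one in w. *)
Lemma normal_poly : q != 1 -> c = (1 - q) * e -> e != 0 ->
    (forall m, m.+1%:R != 0 :> K) ->
  exists (p : {poly K}) (s : K), s != 0 /\ W = horner_alg (wnormal e d u) p /\
    forall j, q ^+ j * p`_j = s * p`_j.
Proof.
move=> q1 cE e0 ch; have [s s0 sE] := normal_eigen.
have /size1_polyC W0E := eigen_size q0 q1 cE e0 ch s0 sE.
exists (symb W 0)`_0, s; split=> //; split; last first.
  by move=> j; apply: (shift_diag cE); rewrite -W0E.
rewrite -(evP e dB); apply/eqP; rewrite -subr_eq0; apply/eqP/(symb_inj q0 dB acts).
rewrite /symb (actB acts) (act_ev dB acts) -/(symb W) -W0E -symb_W.
by rewrite subrr.
Qed.

Lemma horner_alg_inj p r : horner_alg (wnormal e d u) p = horner_alg (wnormal e d u) r -> p = r.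
Proof.
rewrite -!(evP e dB) => /(congr1 (fun z => act z (unitv 0) 0)).
by rewrite !(act_ev dB acts) /pmul /unitv eqxx !mulr1 => /polyC_inj.
Qed.

End NormalElements.

Lemma lrmorph_horner_alg (K : fieldType) (A B : algType K) (f : {lrmorphism A -> B}) x p :
  f (horner_alg x p) = horner_alg (f x) p.
Proof.
elim/poly_ind: p => [|p k IHp]; first by rewrite !rmorph0.
rewrite !rmorphD !rmorphM /= IHp !horner_algX !horner_algC; congr (_ + _).
by rewrite linearZ /= rmorph1.
Qed.

Lemma horner_alg_comp (K : fieldType) (A : algType K) (x : A) p r :
  horner_alg (horner_alg x p) r = horner_alg x (r \Po p).
Proof.
elim/poly_ind: r => [|r k IHr]; first by rewrite comp_poly0 !rmorph0.
by rewrite comp_poly_MXaddC !rmorphD !rmorphM /= IHr !horner_algX !horner_algC.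
Qed.

Lemma rmorph_wnormal (K : fieldType) (A B : algType K) (f : {lrmorphism A -> B}) e d u :
  f (wnormal e d u) = wnormal e (f d) (f u).
Proof. by rewrite /wnormal !linearB linearZ !rmorphM /= rmorph1. Qed.

(** * Comparison of q and q' *)

Section TypeD.
Variable K : fieldType.
Hypothesis char0 : forall m, m.+1%:R != 0 :> K.
Implicit Types (q c : K).

Let e_ q c := c / (1 - q).

Section NormalElement.
Variables (q c : K) (A : algType K) (d u : A).
Hypotheses (dA : downup_algebra (1 + q) (- q) c d u) (q0 : q != 0) (q1 : q != 1).
Local Notation e := (e_ q c).
Local Notation w := (wnormal e d u).

Lemma gammaE : c = (1 - q) * e.
Proof. by rewrite /e_ mulrC mulfVK // subr_eq0 eq_sym. Qed.

Lemma shift_const0 : c - (1 - q) * e = 0.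
Proof. by rewrite -gammaE subrr. Qed.

Lemma w_u0 : w * u = q *: (u * w).
Proof. by rewrite (w_u e dA) shift_const0 scale0r addr0. Qed.

Lemma d_w0 : d * w = q *: (w * d).
Proof. by rewrite (d_w e dA) shift_const0 scale0r addr0. Qed.

Lemma wnormal_normal : normal_elt w.
Proof.
elim/(gen_ind dA) => [|x y [x' xE] [y' yE]|k x [x' xE]|x [x' xE]|x [x' xE]].
- by exists 1; rewrite mulr1 mul1r.
- by exists (x' + y'); rewrite [LHS]mulrDr [RHS]mulrDl xE yE.
- by exists (k *: x'); rewrite -scalerAr xE scalerAl.
- exists (q^-1 *: d * x'); rewrite mulrA -[w * d](scalerK q0) -d_w0.
  by rewrite -!scalerAl -!mulrA xE.
- exists (q *: u * x'); rewrite mulrA w_u0.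
  by rewrite -!scalerAl -!mulrA xE.
Qed.

Lemma wd_neq0 : w * d != 0.
Proof.
have [act acts] := universal_act dA (weight_rel c e q0).
apply/eqP => wd0; have := symb_Wd q0 dA acts w (-1).
rewrite wd0 addNr {1}/symb (act0 acts) => /esym/eqP.
have -> : symb act w 0 = 'X%:P.
  rewrite /symb -(evy e dA) (act_ev dA acts) /pmul /unitv eqxx mulr1 //.
rewrite mulf_eq0 (negPf (weight_neq0 c e q0 _)) /= => /eqP X0.
have := congr1 (shift q c e) X0; rewrite unshiftK // rmorph0 => /eqP.
by rewrite polyC_eq0 polyX_eq0.
Qed.

Lemma char_w (chi : {lrmorphism A -> K^o}) : c != 0 -> chi w = - e.
Proof.
move=> c0; have chid : chi d = 0.
  have := congr1 chi (rel_d dA); rewrite !expr2 !linearD !linearZ !rmorphM /=.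
  rewrite /GRing.scale /= => E; apply: (mulfI c0); rewrite mulr0.
  transitivity (((1 + q) * (chi d * chi u * chi d) + - q * (chi u * (chi d * chi d)) +
    c * chi d) - chi d * chi d * chi u); first by ring.
  by rewrite -E subrr.
rewrite rmorph_wnormal /wnormal chid mulr0 mul0r subrr sub0r.
by rewrite /GRing.scale /= mulr1.
Qed.

End NormalElement.

Section Pair.
Variables (q c q' c' : K) (A B : algType K) (d u : A) (d' u' : B).
Hypotheses (dA : downup_algebra (1 + q) (- q) c d u).
Hypotheses (dB : downup_algebra (1 + q') (- q') c' d' u').
Hypotheses (q0 : q != 0) (q'0 : q' != 0) (c0 : c != 0) (c'0 : c' != 0).
Variables (f : {lrmorphism A -> B}) (g : {lrmorphism B -> A}).
Hypotheses (fK : cancel f g) (gK : cancel g f).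

Lemma e_neq0 p b : p != 1 -> b != 0 -> e_ p b != 0.
Proof. by move=> p1 b0; rewrite mulf_neq0 // invr_eq0 subr_eq0 eq_sym. Qed.

Lemma image_w_normal : q != 1 -> normal_elt (f (wnormal (e_ q c) d u)).
Proof.
move=> q1 z; have [z' zE] := wnormal_normal dA q0 q1 (g z).
by exists (f z'); rewrite -rmorphM -zE rmorphM /= gK.
Qed.

Lemma image_w_symb0 e' act :
    is_action d' u' (weight_d q' c' e') (weight_u (K := K)) act -> q != 1 ->
  symb act (f (wnormal (e_ q c) d u)) 0 != 0.
Proof.
move=> acts q1; have [chi [chid chiu]] := trivial_char dB.
have := symb_at_point q'0 dB acts (f (wnormal (e_ q c) d u)) chid chiu.
have /= -> := char_w dA (chi \o f) c0.
apply: contra_eq_neq => ->; rewrite !horner0 oppr_eq0; exact: e_neq0.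
Qed.

Lemma target_q_neq1 : q != 1 -> q' != 1.
Proof.
move=> q1; apply/eqP => q'1; set w := wnormal (e_ q c) d u.
(* The free parameter e is set to 0, since c' / (1 - q') has no meaning at q' = 1. *)
have [act acts] := universal_act dB (weight_rel c' 0 q'0).
have char_c m : m.+1%:R * c' != 0 by rewrite mulf_neq0.
have := normal_central q'0 dB acts (image_w_normal q1) (image_w_symb0 acts q1) char_c q'1.
move=> /(_ (f d)); rewrite /GRing.comm -!rmorphM => /(can_inj fK) /=.
rewrite d_w0 // => E; have := wd_neq0 dA q0; rewrite -/w.
have /eqP : (q - 1) *: (w * d) = 0 by rewrite scalerBl scale1r E subrr.
rewrite scaler_eq0 subr_eq0 (negPf q1) /= => /eqP ->.
by rewrite eqxx.
Qed.

Lemma image_w_poly : q != 1 -> exists (p : {poly K}) (s : K), s != 0 /\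
  f (wnormal (e_ q c) d u) = horner_alg (wnormal (e_ q' c') d' u') p /\
  forall j, q' ^+ j * p`_j = s * p`_j.
Proof.
move=> q1; have q'1 := target_q_neq1 q1.
have [act acts] := universal_act dB (weight_rel c' (e_ q' c') q'0).
have char_c m : m.+1%:R * c' != 0 by rewrite mulf_neq0.
apply: (normal_poly q'0 dB acts (image_w_normal q1) (image_w_symb0 acts q1) char_c q'1) => //.
  exact: gammaE.
exact: e_neq0.
Qed.

(** On the module w' is diagonal with eigenvalues mu and q' mu. By dw = q wd each nonzero entry of
    the image of d joins eigenvalues of ratio q, which kills the diagonal; a nonzero off-diagonal
    entry gives the claim. If both were 0, w would act as a scalar, against q' <> 1. *)
Lemma ratio_of_2dim_rep k : q != 1 -> q' != 1 -> 1 + q' != 0 -> k != 0 ->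
  f (wnormal (e_ q c) d u) = k *: wnormal (e_ q' c') d' u' -> q' = q \/ q * q' = 1.
Proof.
move=> q1 q'1 q'N1 k0 fw.
have q'n : 1 - q' != 0 by rewrite subr_eq0 eq_sym.
(* With d'^2 = u'^2 = 0 the relations reduce to (1 + q') l + c' = 0. *)
pose l := - c' / (1 + q').
have [rho [rd ru]] : exists rho : {lrmorphism B -> 'M[K]_2},
    rho d' = mx2 0 l 0 0 /\ rho u' = mx2 0 0 1 0.
  apply: (universal_lift dB); rewrite !expr2 !mx2M !mx2Z !mx2D; apply: eq_mx2;
    by rewrite /l; field.
(* This is l - c' / (1 - q'), the eigenvalue of w' on the first basis vector. *)
pose mu := - (2%:R * c') / ((1 + q') * (1 - q')).
have mu0 : mu != 0 by rewrite !mulf_neq0 ?oppr_eq0 ?invr_eq0 ?mulf_neq0 ?(char0 1).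
have rw : rho (f (wnormal (e_ q c) d u)) = mx2 (k * mu) 0 0 (k * mu * q').
  rewrite fw linearZ /= rmorph_wnormal /wnormal rd ru mx2_1.
  rewrite !mx2M mx2Z !mx2B mx2Z.
  by apply: eq_mx2; rewrite /l /mu /e_; field; rewrite ?q'n ?q'N1.
have kmu0 : k * mu != 0 by rewrite mulf_neq0.
have : rho (f d) * rho (f (wnormal (e_ q c) d u)) =
    q *: (rho (f (wnormal (e_ q c) d u)) * rho (f d)).
  by rewrite -!rmorphM /= d_w0 // !linearZ.
rewrite rw.
rewrite [rho (f d)]mx2E; set x := _ 0 0; set y := _ 0 1; set z := _ 1 0; set t := _ 1 1.
rewrite !mx2M mx2Z => /mx2_inj[E1 E2 E3 E4].
have [y0|y0] := eqVneq y 0; last first.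
  left; apply: (mulfI (mulf_neq0 kmu0 y0)).
  transitivity (x * 0 + y * (k * mu * q')); first by ring.
  by rewrite E2; ring.
have [z0|z0] := eqVneq z 0; last first.
  right; apply: (mulfI (mulf_neq0 kmu0 z0)); rewrite mulr1.
  transitivity (q * (0 * x + k * mu * q' * z)); first by ring.
  by rewrite -E3; ring.
have q1n : 1 - q != 0 by rewrite subr_eq0 eq_sym.
have x0 : x = 0.
  apply: (mulfI (mulf_neq0 q1n kmu0)); rewrite mulr0.
  transitivity (x * (k * mu) + y * 0 - q * (k * mu * x + 0 * z)); first by ring.
  by rewrite E1 subrr.
have t0 : t = 0.
  apply: (mulfI (mulf_neq0 q1n (mulf_neq0 kmu0 q'0))); rewrite mulr0.
  transitivity (z * 0 + t * (k * mu * q') - q * (0 * y + k * mu * q' * t)); first by ring.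
  by rewrite E4 subrr.
have rd0 : rho (f d) = 0.
  rewrite [LHS]mx2E -/x -/y -/z -/t x0 y0 z0 t0.
  by apply/matrixP => i j; rewrite !mxE; case: ifP; case: ifP.
move: rw; rewrite !rmorph_wnormal /wnormal rd0 mul0r mulr0 subrr sub0r mx2_1.
rewrite -scaleN1r !mx2Z => /mx2_inj[F1 _ _ F4].
exfalso; move/eqP: q'1; apply; apply: (mulfI kmu0); rewrite -F4 mulr1 -F1.
by ring.
Qed.

End Pair.

Lemma image_w_scalar (q c q' c' : K) (A B : algType K) (d u : A) (d' u' : B)
    (f : {lrmorphism A -> B}) (g : {lrmorphism B -> A}) :
    downup_algebra (1 + q) (- q) c d u -> downup_algebra (1 + q') (- q') c' d' u' ->
    q != 0 -> q' != 0 -> c != 0 -> c' != 0 -> cancel f g -> cancel g f -> q != 1 ->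
  exists2 k, k != 0 & f (wnormal (e_ q c) d u) = k *: wnormal (e_ q' c') d' u'.
Proof.
move=> dA dB q0 q'0 c0 c'0 fK gK q1; have q'1 := target_q_neq1 dA dB q0 q'0 c0 c'0 fK gK q1.
have [p [s [s0 [fw pE]]]] := image_w_poly dA dB q0 q'0 c0 c'0 fK gK q1.
have [r [_ [_ [gw _]]]] := image_w_poly dB dA q'0 q0 c'0 c0 gK fK q'1.
have rp : r \Po p = 'X.
  have [act acts] := universal_act dB (weight_rel c' (e_ q' c') q'0).
  apply: (horner_alg_inj dB acts).
  by rewrite -horner_alg_comp -fw -lrmorph_horner_alg -gw gK horner_algX.
(* Degrees multiply under composition, so p has degree 1. *)
have : (size p).-1 = 1%N.
  have /eqP := size_comp_poly r p; rewrite rp size_polyX /= eq_sym muln_eq1.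
  by case/andP => _ /eqP.
case sp: (size p) => [|[|[|//]]] // _.
have p1 : p`_1 != 0.
  by have := lead_coef_eq0 p; rewrite /lead_coef sp /= => ->; rewrite -size_poly_eq0 sp.
(* The linear coefficient gives s = q'; a nonzero constant coefficient would give s = 1. *)
have sq : s = q' by apply: (mulIf p1); rewrite -pE expr1.
have p0 : p`_0 = 0.
  apply/eqP; apply: contraT => p00; have := pE 0%N; rewrite expr0 => /(mulIf p00) /eqP.
  by rewrite sq eq_sym (negPf q'1).
exists p`_1 => //; rewrite fw.
have -> : p = p`_1 *: 'X.
  apply/polyP => -[|[|i]]; rewrite coefZ coefX /= ?mulr0 ?mulr1 //.
  by rewrite nth_default // sp.
by rewrite -mul_polyC rmorphM /= horner_algC horner_algX -scalerAl mul1r coefCM coefX mulr1.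
Qed.

(** The two-dimensional module needs 1 + q' <> 0. For q' = -1 the roles of f and its inverse are
    exchanged, unless q = -1 as well, and then q' = q. *)
Lemma typeD_q (q c q' c' : K) (A B : algType K) (d u : A) (d' u' : B)
    (f : {lrmorphism A -> B}) (g : {lrmorphism B -> A}) :
    downup_algebra (1 + q) (- q) c d u -> downup_algebra (1 + q') (- q') c' d' u' ->
    q != 0 -> q' != 0 -> c != 0 -> c' != 0 -> cancel f g -> cancel g f ->
  q' = q \/ q * q' = 1.
Proof.
move=> dA dB q0 q'0 c0 c'0 fK gK.
have [q1|q1] := eqVneq q 1.
  have [q'1|q'1] := eqVneq q' 1; first by left; rewrite q1.
  by have := target_q_neq1 dB dA q'0 q0 c'0 c0 gK fK q'1; rewrite q1 eqxx.
have q'1 := target_q_neq1 dA dB q0 q'0 c0 c'0 fK gK q1.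
have [q'N|q'N] := eqVneq (1 + q') 0; last first.
  have [k k0 fw] := image_w_scalar dA dB q0 q'0 c0 c'0 fK gK q1.
  exact: (ratio_of_2dim_rep dA dB q'0 c'0 q1 q'1 q'N k0 fw).
have [qN|qN] := eqVneq (1 + q) 0; last first.
  have [k k0 gw] := image_w_scalar dB dA q'0 q0 c'0 c0 gK fK q'1.
  have [->|<-] := ratio_of_2dim_rep dB dA q0 c0 q'1 q1 qN k0 gw; first by left.
  by right; rewrite mulrC.
by left; apply: (addrI 1); rewrite q'N qN.
Qed.

End TypeD.

Lemma typeD_iso (K : fieldType) (a b c a' b' c' : K) (A B : algType K) (d u : A)
    (d' u' : B) (f : {lrmorphism A -> B}) (g : {lrmorphism B -> A}) :
    downup_algebra a b c d u -> downup_algebra a' b' c' d' u' ->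
    cancel f g -> cancel g f -> b != 0 -> b' != 0 -> c != 0 -> c' != 0 ->
    a + b = 1 -> a' + b' = 1 -> [pchar K] =i pred0 ->
  same_params a b a' b'.
Proof.
move=> dA dB fK gK b0 b'0 c0 c'0 ab ab' ch.
have char0 m : m.+1%:R != 0 :> K by rewrite (pcharf0P K).1.
have aE : a = 1 - b by rewrite -ab addrK.
have a'E : a' = 1 - b' by rewrite -ab' addrK.
have dA' : downup_algebra (1 + - b) (- - b) c d u by rewrite opprK -aE.
have dB' : downup_algebra (1 + - b') (- - b') c' d' u' by rewrite opprK -a'E.
have [||bb|bb] := typeD_q char0 dA' dB' _ _ c0 c'0 fK gK; rewrite ?oppr_eq0 //.
  by left; move/oppr_inj: bb => bb; rewrite a'E bb aE.
rewrite mulrNN in bb; have b'E : b' = b^-1 by rewrite -[b^-1]mulr1 -bb mulKf.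
by right; split=> //; rewrite a'E b'E aE; field.
Qed.

Theorem theorem4p5 (K : closedFieldType) (alpha beta gamma alpha' beta' gamma' : K)
  (noethA : noetherian (downup alpha beta gamma))
  (noethA' : noetherian (downup alpha' beta' gamma'))
  (same_type : downup_type alpha beta gamma = downup_type alpha' beta' gamma')
  (char0 : downup_type alpha beta gamma = TypeD ->
           downup_type alpha' beta' gamma' = TypeD -> [pchar K] =i pred0) :
  alg_isomorphic (downup alpha beta gamma) (downup alpha' beta' gamma') <->
  (gamma = 0 <-> gamma' = 0) /\
  ((alpha' = alpha /\ beta' = beta) \/
   (alpha' = - alpha * beta^-1 /\ beta' = beta^-1)).
Proof.
have b0 := noetherian_beta_neq0 noethA; have b'0 := noetherian_beta_neq0 noethA'.
split=> [iso|[gammaP params]]; last exact: downup_iso.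
move: same_type char0 iso {noethA noethA'}; rewrite /downup_type.
case: (eqVneq gamma 0) => [->|c0]; case: (eqVneq gamma' 0) => [->|c'0].
- by move=> _ _ /(downup_gamma0_iso b0).
- by case: ifP; case: ifP.
- by case: ifP; case: ifP.
have gammaP : gamma = 0 <-> gamma' = 0 by split=> /eqP; rewrite ?(negPf c0) ?(negPf c'0).
case: (eqVneq (alpha + beta) 1) => [ab|ab];
  case: (eqVneq (alpha' + beta') 1) => [ab'|ab'] // _ ch iso; split=> //;
  have [f [g [fK gK]]] := alg_isomorphic_inv iso;
  have dA := downup_is_downup alpha beta gamma;
  have dB := downup_is_downup alpha' beta' gamma'.
- exact: (typeD_iso dA dB fK gK b0 b'0 c0 c'0 ab ab' (ch erefl erefl)).
- exact: (typeC_iso dA dB fK gK b0 b'0 c0 c'0 ab ab').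
Qed.
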